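(* Let $a=(a_1,\dots,a_n)$ be a tuple of distinct complex numbers ($n\ge1$), $\alpha=(\alpha_1,\dots,\alpha_n)\in\mathbb{C}^n$ and $\beta\in\mathbb{C}$, and let $V(\alpha,\beta)=R_az$ be the corresponding module of densities over $\mathscr{V}_a$. (a) The $\mathscr{V}_a$-module $V(\alpha,\beta)$ is reducible if and only if (1) $\beta=0$ and $\alpha\in\mathbb{Z}^n$; or (2) $\beta=1$ and $n\ge2$; or (3) $\beta=1$, $n=1$ and $\alpha\in\mathbb{Z}$. (b) If $\beta=0$ and $\alpha\in\mathbb{Z}^n$, then $V(\alpha,\beta)$ has only one nonzero proper submodule, and it is $1$-dimensional. (c) If $\beta=1$, then $V(\alpha,\beta)$ has a smallest nonzero submodule $\partial(R_az)$, which is irreducible; $V(\alpha,\beta)/\partial(R_az)$ is a module with trivial action, and it is $0$ if and only if $n=1$ and $\alpha\notin\mathbb{Z}$. If in addition $\alpha\in\mathbb{Z}^n$, then, identifying $R_az$ with $R_a$ by setting $z=\prod_{i=1}^n(t-a_i)^{\alpha_i}\in R_a$, $$\partial(R_az)=\sum_{k\in\mathbb{Z}_+}\mathbb{C}\,t^k\oplus\sum_{i=1}^n\sum_{k\in\mathbb{N}}\mathbb{C}\,(t-a_i)^{-k-1},$$ and $\dim(R_az/\partial(R_az))=n$. (d) If $\beta=1$ and $\alpha\notin\mathbb{Z}^n$, then $\partial(R_az)\cong V(\alpha,0)$ as $\mathscr{V}_a$-modules. (e) If $n=1$ and $\alpha\notin\mathbb{Z}$, then $V(\alpha,0)\cong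 V(\alpha,1)$ as $\mathscr{V}_a$-modules.
   Context: $\mathbb{N}=\{1,2,\dots\}$, $\mathbb{Z}_+=\{0,1,2,\dots\}$. $R_a$ is the subalgebra of $\mathbb{C}(t)$ generated by $t,(t-a_1)^{-1},\dots,(t-a_n)^{-1}$, and $\mathscr{V}_a=\operatorname{Der}(R_a)=R_a\partial$ with $\partial=d/dt$, a Lie algebra with bracket $[f\partial,g\partial]=(f\partial(g)-g\partial(f))\partial$. $V(\alpha,\beta)=R_az$ is the free rank-one $R_a$-module with generator $z$; define the linear map $\partial:R_az\to R_az$ by $\partial(gz)=\partial(g)z+g\sum_{j=1}^n\frac{\alpha_j}{t-a_j}z$, and let $\mathscr{V}_a$ act by $(f\partial)\cdot(gz)=f\,\partial(gz)+\beta\,\partial(f)\,g z$ for $f,g\in R_a$. $\partial(R_az)=\{\partial(gz)\mid g\in R_a\}$. *)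

(* Defs.v *)
From HB Require Import structures.
From mathcomp Require Import all_boot all_order all_algebra.
From mathcomp Require Import boolp.
From mathcomp Require Import ring.

Set Implicit Arguments.
Unset Strict Implicit.
Unset Printing Implicit Defensive.

Import GRing.Theory.
Local Open Scope ring_scope.
Local Open Scope quotient_scope.

HB.mixin Record Lmodule_isLie (F : fieldType) L of GRing.Lmodule F L := {
  lie_bracket : L -> L -> L;
  lie_bracket_linearl : forall y, linear (lie_bracket^~ y);
  lie_bracket_linearr : forall x, linear (lie_bracket x);
  lie_bracketxx : forall x, lie_bracket x x = 0;
  lie_jacobi : forall x y z,
    lie_bracket x (lie_bracket y z) + lie_bracket y (lie_bracket z x)
      + lie_bracket z (lie_bracket x y) = 0
}.

#[short(type="lieAlgType")]
HB.structure Definition LieAlgebra (F : fieldType) :=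
  {L of GRing.Lmodule F L & Lmodule_isLie F L}.

HB.mixin Record Lmodule_isLieModule (F : fieldType) (L : lieAlgType F) M
    of GRing.Lmodule F M := {
  lie_act : L -> M -> M;
  lie_act_linearl : forall v, linear (lie_act^~ v);
  lie_act_linearr : forall x, linear (lie_act x);
  lie_act_bracket : forall x y v,
    lie_act (lie_bracket x y) v = lie_act x (lie_act y v) - lie_act y (lie_act x v)
}.

#[short(type="lieModType")]
HB.structure Definition LieModule (F : fieldType) (L : lieAlgType F) :=
  {M of GRing.Lmodule F M & Lmodule_isLieModule F L M}.

Record lieSubmodule (F : fieldType) (L : lieAlgType F) (M : lieModType L) :=
  LieSubmodule {
    lsub_pred :> {pred M};
    lsub_closed : submod_closed lsub_pred;
    lsub_act : forall (x : L) (v : M), v \in lsub_pred -> lie_act x v \in lsub_pred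
  }.

HB.instance Definition _ (F : fieldType) (L : lieAlgType F) (M : lieModType L)
    (W : lieSubmodule M) :=
  GRing.isSubmodClosed.Build F M (lsub_pred W) (lsub_closed W).

Section LieModules.
Variables (F : fieldType) (L : lieAlgType F).

Section SubQuotient.
Variables (M : lieModType L) (W : lieSubmodule M).

Record lie_submod := Submod { submod_val : M; _ : submod_val \in W }.

HB.instance Definition _ := [isSub for submod_val].
HB.instance Definition _ := [Choice of lie_submod by <:].
HB.instance Definition _ := [SubChoice_isSubLmodule of lie_submod by <:].

Definition lie_submod_act (x : L) (v : lie_submod) : lie_submod :=
  Submod (lsub_act x (valP v)).

Fact lie_submod_act_linearl v : linear (lie_submod_act^~ v).
Proof. by move=> c x y; apply/val_inj; rewrite linearP /= lie_act_linearl. Qed.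

Fact lie_submod_act_linearr x : linear (lie_submod_act x).
Proof.
move=> c u v; apply/val_inj; rewrite linearP /=.
by rewrite -lie_act_linearr; congr lie_act; rewrite linearP.
Qed.

Fact lie_submod_act_bracket x y v :
  lie_submod_act (lie_bracket x y) v
    = lie_submod_act x (lie_submod_act y v) - lie_submod_act y (lie_submod_act x v).
Proof. by apply/val_inj; rewrite linearB /= lie_act_bracket. Qed.

HB.instance Definition _ := Lmodule_isLieModule.Build F L lie_submod
  lie_submod_act_linearl lie_submod_act_linearr lie_submod_act_bracket.

Definition lie_quot := Quotient.quot W.
HB.instance Definition _ := GRing.Zmodule.on lie_quot.

Definition lie_quot_pi (v : M) : lie_quot := \pi_(Quotient.quot W) v.

Definition lie_quot_scale (c : F) (u : lie_quot) : lie_quot :=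
  lie_quot_pi (c *: repr (u : Quotient.quot W)).
Definition lie_quot_act (x : L) (u : lie_quot) : lie_quot :=
  lie_quot_pi (lie_act x (repr (u : Quotient.quot W))).

Lemma lie_quot_ind (P : lie_quot -> Prop) : (forall v, P (lie_quot_pi v)) -> forall u, P u.
Proof. move=> Ppi u; have := Ppi (repr (u : Quotient.quot W)).
by rewrite /lie_quot_pi reprK. Qed.

Lemma lie_quot_eq (u v : M) : lie_quot_pi u = lie_quot_pi v <-> u - v \in W.
Proof. by rewrite (Quotient.idealrBE W); split=> /eqP. Qed.

Fact lie_quot_repr (v : M) : repr (lie_quot_pi v : Quotient.quot W) - v \in W.
Proof. by apply/lie_quot_eq; rewrite /lie_quot_pi reprK. Qed.

Lemma lie_quot_scale_pi c v : lie_quot_scale c (lie_quot_pi v) = lie_quot_pi (c *: v).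
Proof. by apply/lie_quot_eq; rewrite -scalerBr rpredZ // lie_quot_repr. Qed.

Lemma lie_quot_act_pi x v : lie_quot_act x (lie_quot_pi v) = lie_quot_pi (lie_act x v).
Proof.
apply/lie_quot_eq.
have -> u w : lie_act x u - lie_act x w = lie_act x (u - w) :> M.
  by rewrite -scaleN1r addrC -lie_act_linearr scaleN1r addrC.
exact/lsub_act/lie_quot_repr.
Qed.

Fact lie_quot_pi_zmod : zmod_morphism lie_quot_pi.
Proof. exact: (raddfB (\pi_(Quotient.quot W))). Qed.

HB.instance Definition _ := GRing.isZmodMorphism.Build M lie_quot lie_quot_pi lie_quot_pi_zmod.

Fact lie_quot_scalerA b c u : lie_quot_scale b (lie_quot_scale c u) = lie_quot_scale (b * c) u.
Proof. by elim/lie_quot_ind: u => u; rewrite !lie_quot_scale_pi scalerA. Qed.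

Fact lie_quot_scale1r : left_id 1 lie_quot_scale.
Proof. by elim/lie_quot_ind=> u; rewrite lie_quot_scale_pi scale1r. Qed.

Fact lie_quot_scalerDr : right_distributive lie_quot_scale +%R.
Proof.
move=> c; elim/lie_quot_ind=> u; elim/lie_quot_ind=> v.
by rewrite -raddfD !lie_quot_scale_pi -raddfD scalerDr.
Qed.

Fact lie_quot_scalerDl u : {morph lie_quot_scale^~ u : b c / b + c}.
Proof.
by move=> b c; elim/lie_quot_ind: u => u; rewrite !lie_quot_scale_pi -raddfD scalerDl.
Qed.

HB.instance Definition _ := GRing.Zmodule_isLmodule.Build F lie_quot
  lie_quot_scalerA lie_quot_scale1r lie_quot_scalerDr lie_quot_scalerDl.

Fact lie_quot_pi_scalable : scalable lie_quot_pi.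
Proof. by move=> c u; rewrite -lie_quot_scale_pi. Qed.

HB.instance Definition _ :=
  GRing.isScalable.Build F M lie_quot *:%R lie_quot_pi lie_quot_pi_scalable.

Fact lie_quot_act_linearl u : linear (lie_quot_act^~ u).
Proof.
by move=> c x y; elim/lie_quot_ind: u => u; rewrite !lie_quot_act_pi lie_act_linearl linearP.
Qed.

Fact lie_quot_act_linearr x : linear (lie_quot_act x).
Proof.
move=> c; elim/lie_quot_ind=> u; elim/lie_quot_ind=> v.
by rewrite -linearP !lie_quot_act_pi lie_act_linearr linearP.
Qed.

Fact lie_quot_act_bracket x y u :
  lie_quot_act (lie_bracket x y) u
    = lie_quot_act x (lie_quot_act y u) - lie_quot_act y (lie_quot_act x u).
Proof.
by elim/lie_quot_ind: u => u; rewrite !lie_quot_act_pi lie_act_bracket raddfB.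
Qed.

HB.instance Definition _ := Lmodule_isLieModule.Build F L lie_quot
  lie_quot_act_linearl lie_quot_act_linearr lie_quot_act_bracket.

Definition submod_nonzero := exists2 v : M, v \in W & v != 0.
Definition submod_proper := exists v : M, v \notin W.

End SubQuotient.

Definition lie_reducible (M : lieModType L) :=
  exists W : lieSubmodule M, submod_nonzero W /\ submod_proper W.

Definition lie_irreducible (M : lieModType L) :=
  (exists v : M, v != 0) /\ ~ lie_reducible M.

Definition lie_trivial (M : lieModType L) :=
  forall (x : L) (v : M), lie_act x v = 0.

Definition lie_isomorphic (M N : lieModType L) :=
  exists phi : {linear M -> N},
    bijective phi /\ forall x v, phi (lie_act x v) = lie_act x (phi v).

End LieModules.

(* Vector.axiom n V is the type of linear bijections from V onto 'rV_n. *)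
Definition has_dim (F : fieldType) (V : lmodType F) (n : nat) :=
  inhabited (Vector.axiom n V).

Definition lin_span (F : fieldType) (V : lmodType F) (X : V -> Prop) : {pred V} :=
  [pred v | `[< forall S : {pred V}, submod_closed S ->
                  (forall x, X x -> x \in S) -> v \in S >]].

Definition alg_gen (F : fieldType) (A : lalgType F) (X : A -> Prop) : {pred A} :=
  [pred v | `[< forall S : {pred A}, subalg_closed S ->
                  (forall x, X x -> x \in S) -> v \in S >]].

Lemma alg_gen_closed (F : fieldType) (A : lalgType F) (X : A -> Prop) :
  subalg_closed (alg_gen X).
Proof.
split.
- by apply/asboolP=> S [S1 _ _] _.
- move=> c u v /asboolP Su /asboolP Sv; apply/asboolP=> S clS XS.
  by case: (clS) => _ lS _; apply: lS; [apply: Su | apply: Sv].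
- move=> u v /asboolP Su /asboolP Sv; apply/asboolP=> S clS XS.
  by case: (clS) => _ _ mS; apply: mS; [apply: Su | apply: Sv].
Qed.

Lemma mem_alg_gen (F : fieldType) (A : lalgType F) (X : A -> Prop) x :
  X x -> x \in alg_gen X.
Proof. by move=> Xx; apply/asboolP=> S _; apply. Qed.

Fact quotient_rule (K : fieldType) (f m d p q dm dd dp dq : K) :
  d != 0 -> f * d = m -> f * q = p -> dp * d + p * dd = dm * q + m * dq ->
  (dm * d - m * dd) / (d * d) * q + f * dq = dp.
Proof.
move=> d0 <- <- e; apply: (mulIf d0).
have -> : dp * d = dm * q + f * d * dq - f * q * dd by rewrite -e addrK.
by field.
Qed.

Fact inverse_rule (K : fieldType) (f df dv : K) :
  f != 0 -> 0 = df * f^-1 + f * dv -> dv = - df / f ^+ 2.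
Proof.
move=> f0 e; apply: (mulfI f0).
have -> : f * dv = 0 - df * f^-1 by rewrite e addrC addKr.
by field.
Qed.

Section DerivationIdentities.
Variables (F : fieldType) (A : comAlgType F) (D : {linear A -> A}).
Hypothesis DM : forall f g, D (f * g) = D f * g + f * D g.

Fact scale_mul (c : F) : exists k : A, forall x : A, c *: x = k * x.
Proof. by exists c%:A => x; rewrite mulr_algl. Qed.

Definition der_bracket (f g : A) : A := f * D g - g * D f.

Fact der_bracket_linearl g : linear (der_bracket^~ g).
Proof.
move=> c u v; have [k kE] := scale_mul c; rewrite /der_bracket linearP !kE; ring.
Qed.
Fact der_bracket_linearr f : linear (der_bracket f).
Proof.
move=> c u v; have [k kE] := scale_mul c; rewrite /der_bracket linearP !kE; ring.
Qed.
Fact der_jacobi f g h :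
  der_bracket f (der_bracket g h) + der_bracket g (der_bracket h f)
    + der_bracket h (der_bracket f g) = 0.
Proof. by rewrite /der_bracket !(linearB, DM) /=; ring. Qed.

Variables (s : A) (b : F).
Definition der_act (f g : A) : A := f * (D g + g * s) + b *: (D f * g).

Fact der_act_linearl g : linear (der_act^~ g).
Proof.
move=> c u v; have [k kE] := scale_mul c; have [l lE] := scale_mul b.
by rewrite /der_act linearP /= !(kE, lE); ring.
Qed.
Fact der_act_linearr f : linear (der_act f).
Proof.
move=> c u v; have [k kE] := scale_mul c; have [l lE] := scale_mul b.
by rewrite /der_act linearP /= !(kE, lE); ring.
Qed.
Fact der_act_bracket f g v :
  der_act (der_bracket f g) v = der_act f (der_act g v) - der_act g (der_act f v).
Proof.
have [l lE] := scale_mul b.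
by rewrite /der_act /der_bracket !(linearB, linearD, DM, linearZ) /= ?DM !lE; ring.
Qed.
End DerivationIdentities.

Section RationalFunctions.
Variable F : fieldType.

Definition ratfun := {fraction {poly F}}.
HB.instance Definition _ := GRing.Field.on ratfun.

Definition ratC (p : {poly F}) : ratfun := FracField.tofrac p.

Fact ratC_zmod : zmod_morphism ratC.
Proof. exact: tofrac_is_zmod_morphism. Qed.
Fact ratC_monoid : monoid_morphism ratC.
Proof. exact: tofrac_is_monoid_morphism. Qed.
HB.instance Definition _ :=
  GRing.isZmodMorphism.Build {poly F} ratfun ratC ratC_zmod.
HB.instance Definition _ :=
  GRing.isMonoidMorphism.Build {poly F} ratfun ratC ratC_monoid.


Definition rat_scale (c : F) (f : ratfun) : ratfun := ratC c%:P * f.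

Fact rat_scalerA b c f : rat_scale b (rat_scale c f) = rat_scale (b * c) f.
Proof. by rewrite /rat_scale polyCM rmorphM mulrA. Qed.
Fact rat_scale1r : left_id 1 rat_scale.
Proof. by move=> f; rewrite /rat_scale polyC1 rmorph1 mul1r. Qed.
Fact rat_scalerDr : right_distributive rat_scale +%R.
Proof. by move=> c f g; rewrite /rat_scale mulrDr. Qed.
Fact rat_scalerDl f : {morph rat_scale^~ f : b c / b + c}.
Proof. by move=> b c; rewrite /rat_scale polyCD rmorphD mulrDl. Qed.

HB.instance Definition _ := GRing.Zmodule_isLmodule.Build F ratfun
  rat_scalerA rat_scale1r rat_scalerDr rat_scalerDl.

Fact rat_scalerAl c (f g : ratfun) : c *: (f * g) = (c *: f) * g.
Proof. exact: mulrA. Qed.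
HB.instance Definition _ := GRing.Lmodule_isLalgebra.Build F ratfun rat_scalerAl.
HB.instance Definition _ := GRing.Lalgebra_isComAlgebra.Build F ratfun.


(* The quotient rule on a representative numerator and denominator; it does not
   depend on the representative, by rat_derivP. *)
Definition rat_deriv (f : ratfun) : ratfun :=
  let p := \n_(repr (f : {fraction {poly F}})) in
  let q := \d_(repr (f : {fraction {poly F}})) in
  ratC (p^`() * q - p * q^`()) / ratC (q ^+ 2).

Lemma ratC_eq0 (p : {poly F}) : (ratC p == 0) = (p == 0).
Proof. exact: tofrac_eq0. Qed.

Fact rat_numden (f : ratfun) :
  f * ratC \d_(repr (f : {fraction {poly F}})) = ratC \n_(repr (f : {fraction {poly F}})).
Proof.
rewrite /ratC /=; set x := repr _.
have -> : f = \pi_{fraction {poly F}} x :> {fraction {poly F}} by rewrite reprK.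
unlock FracField.tofrac; rewrite -[LHS]FracField.pi_mul; apply/eqmodP => /=.
rewrite FracField.equivfE /FracField.mulf !numden_Ratio ?oner_eq0 ?mulf_neq0 ?oner_eq0 //.
  by rewrite !mulr1 mulrC.
all: exact: denom_ratioP.
Qed.

Lemma rat_derivP (f : ratfun) (p q : {poly F}) : q != 0 -> f * ratC q = ratC p ->
  rat_deriv f * ratC q + f * ratC q^`() = ratC p^`().
Proof.
move=> q0 fq; rewrite /rat_deriv; have := rat_numden f.
have := denom_ratioP (repr (f : {fraction {poly F}})).
set d := \d__; set m := \n__ => d0 fd.
have D0 : ratC d != 0 by rewrite ratC_eq0.
have Q0 : ratC q != 0 by rewrite ratC_eq0.
have /(congr1 (fun r => ratC r^`())) : p * d = m * q.
  apply/eqP; rewrite -tofrac_eq; apply/eqP.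
  by rewrite -!/(ratC _) !rmorphM /= -fq -fd mulrAC.
rewrite !derivM !(rmorphB, rmorphD, rmorphM, rmorphXn) /= => e.
exact (@quotient_rule ratfun f (ratC m) (ratC d) (ratC p) (ratC q) _ _ _ _ D0 fd fq e).
Qed.

Lemma rat_deriv_uniq (f g : ratfun) (p q : {poly F}) : q != 0 -> f * ratC q = ratC p ->
  g * ratC q + f * ratC q^`() = ratC p^`() -> g = rat_deriv f.
Proof.
move=> q0 fq gq; apply: (@mulIf _ (ratC q)); first by rewrite ratC_eq0.
by apply: (addIr (f * ratC q^`())); rewrite gq (rat_derivP q0 fq).
Qed.

Lemma rat_deriv_linear : linear rat_deriv.
Proof.
move=> c f g; symmetry.
have := denom_ratioP (repr (f : {fraction {poly F}})).
have := denom_ratioP (repr (g : {fraction {poly F}})).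
have := rat_numden f; have := rat_numden g.
set q1 := \d__; set p1 := \n__; set q2 := \d__; set p2 := \n__ => e1 e2 n1 n2.
have d1 := rat_derivP n1 e1; have d2 := rat_derivP n2 e2.
apply: (@rat_deriv_uniq _ _ (c%:P * p2 * q1 + p1 * q2) (q1 * q2)).
- by rewrite mulf_neq0.
- rewrite !(rmorphD, rmorphM) /= -e1 -e2 /GRing.scale /= /rat_scale; ring.
- rewrite !(derivM, derivD, derivC, rmorphD, rmorphM, rmorph0) /= -d1 -d2 -e1 -e2.
  rewrite /GRing.scale /= /rat_scale; ring.
Qed.

HB.instance Definition _ :=
  GRing.isLinear.Build F ratfun ratfun *:%R rat_deriv rat_deriv_linear.

Lemma rat_derivM (f g : ratfun) :
  rat_deriv (f * g) = rat_deriv f * g + f * rat_deriv g.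
Proof.
symmetry.
have := denom_ratioP (repr (f : {fraction {poly F}})).
have := denom_ratioP (repr (g : {fraction {poly F}})).
have := rat_numden f; have := rat_numden g.
set q1 := \d__; set p1 := \n__; set q2 := \d__; set p2 := \n__ => e1 e2 n1 n2.
have d1 := rat_derivP n1 e1; have d2 := rat_derivP n2 e2.
apply: (@rat_deriv_uniq _ _ (p2 * p1) (q1 * q2)).
- by rewrite mulf_neq0.
- rewrite !rmorphM /= -e1 -e2; ring.
- rewrite !(derivM, rmorphD, rmorphM) /= -d1 -d2 -e1 -e2; ring.
Qed.

Lemma rat_derivC (p : {poly F}) : rat_deriv (ratC p) = ratC p^`().
Proof.
have e : ratC p * ratC 1 = ratC p by rewrite rmorph1 mulr1.
by have := rat_derivP (oner_neq0 _) e; rewrite derivC rmorph0 rmorph1 mulr0 addr0 mulr1.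
Qed.

Lemma rat_derivV (f : ratfun) : rat_deriv f^-1 = - rat_deriv f / f ^+ 2.
Proof.
have [->|f0] := eqVneq f 0; first by rewrite invr0 linear0 oppr0 mul0r.
have := rat_derivM f f^-1; rewrite mulfV // -(rmorph1 (@ratC)) rat_derivC.
rewrite derivC rmorph0; exact (@inverse_rule ratfun f _ _ f0).
Qed.

End RationalFunctions.

Section DensityModules.
Variables (F : fieldType) (n : nat) (a : 'I_n -> F).

Definition ra_gen (f : ratfun F) : Prop :=
  f = ratC 'X \/ exists i, f = (ratC ('X - (a i)%:P))^-1.

Definition ra_pred : {pred ratfun F} := alg_gen ra_gen.

HB.instance Definition _ :=
  GRing.isSubalgClosed.Build F (ratfun F) ra_pred (alg_gen_closed ra_gen).

Record Ra := MkRa { ra_val : ratfun F; _ : ra_val \in ra_pred }.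

HB.instance Definition _ := [isSub for ra_val].
HB.instance Definition _ := [Choice of Ra by <:].
HB.instance Definition _ := [SubChoice_isSubComNzRing of Ra by <:].
HB.instance Definition _ := [SubZmodule_isSubLmodule of Ra by <:].
HB.instance Definition _ := [SubNzRing_SubLmodule_isSubLalgebra of Ra by <:].
HB.instance Definition _ := [SubLalgebra_isSubAlgebra of Ra by <:].

Lemma rat_deriv_ra (f : ratfun F) : f \in ra_pred -> rat_deriv f \in ra_pred.
Proof.
suff : f \in ra_pred -> (f \in ra_pred) && (rat_deriv f \in ra_pred).
  by move=> H /H /andP[].
move=> /asboolP /(_ [pred f | (f \in ra_pred) && (rat_deriv f \in ra_pred)]).
apply.
  split.
  - by rewrite inE rpred1 -(rmorph1 (@ratC F)) rat_derivC derivC !rmorph0 rpred0.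
  - move=> c u v /andP[u1 u2] /andP[v1 v2].
    by rewrite inE linearP /= !rpredD ?rpredZ.
  - move=> u v /andP[u1 u2] /andP[v1 v2].
    rewrite inE; apply/andP; split; first exact: rpredM.
    by rewrite rat_derivM; apply: rpredD; apply: rpredM.
move=> x gx; rewrite inE mem_alg_gen //=; case: gx => [->|[i ->]].
- by rewrite rat_derivC derivX rmorph1 rpred1.
- have pl : (ratC ('X - (a i)%:P))^-1 \in ra_pred by apply: mem_alg_gen; right; exists i.
  by rewrite rat_derivV rat_derivC derivXsubC rmorph1 mulN1r rpredN -exprVn rpredX.
Qed.

Definition ra_deriv (f : Ra) : Ra := MkRa (rat_deriv_ra (valP f)).

Fact ra_deriv_linear : linear ra_deriv.
Proof. by move=> c f g; apply/val_inj; rewrite /= !linearP. Qed.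

HB.instance Definition _ := GRing.isLinear.Build F Ra Ra *:%R ra_deriv ra_deriv_linear.

Lemma ra_derivM f g : ra_deriv (f * g) = ra_deriv f * g + f * ra_deriv g.
Proof. by apply/val_inj; rewrite /= rat_derivM. Qed.

Lemma ra_pole_subproof i : (ratC ('X - (a i)%:P))^-1 \in ra_pred.
Proof. by apply: mem_alg_gen; right; exists i. Qed.

Definition ra_pole i : Ra := MkRa (ra_pole_subproof i).

Lemma ra_t_subproof : ratC 'X \in ra_pred.
Proof. by apply: mem_alg_gen; left. Qed.

Definition ra_t : Ra := MkRa ra_t_subproof.

Lemma ra_derivation (D : {linear Ra -> Ra}) :
  (forall f g, D (f * g) = D f * g + f * D g) -> forall g, D g = D ra_t * ra_deriv g.
Proof.
move=> DM g.
pose P (h : Ra) := D h = D ra_t * ra_deriv h.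
have D1 : D 1 = 0.
  by apply: (addIr (D 1)); rewrite add0r -[in RHS](mulr1 1) DM mulr1 mul1r.
have d1 : ra_deriv 1 = 0.
  by apply: (addIr (ra_deriv 1)); rewrite add0r -[in RHS](mulr1 1) ra_derivM mulr1 mul1r.
have dt : ra_deriv ra_t = 1.
  by apply/val_inj; rewrite /= rat_derivC derivX rmorph1.
have P1 : P 1 by rewrite /P D1 d1 mulr0.
have PD c u v : P u -> P v -> P (c *: u + v).
  by rewrite /P !linearP => -> -> /=; rewrite mulrDr scalerAr.
have PM u v : P u -> P v -> P (u * v).
  by rewrite /P DM ra_derivM => -> -> ; rewrite mulrDr !mulrA [u * _]mulrC.
have Pt : P ra_t by rewrite /P dt mulr1.
have Pp i : P (ra_pole i).
  have e : ra_pole i * (ra_t - (a i)%:A) = 1.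
    apply/val_inj; rewrite /= /GRing.scale /= /rat_scale mulr1 -rmorphB.
    by rewrite mulVf // ratC_eq0 polyXsubC_eq0.
  have inv (E : {linear Ra -> Ra}) : (forall f g, E (f * g) = E f * g + f * E g) ->
      E 1 = 0 -> E (ra_pole i) = - (ra_pole i * ra_pole i * E ra_t).
    move=> EM E1; have := EM (ra_pole i) (ra_t - (a i)%:A).
    have Es : E (ra_t - (a i)%:A) = E ra_t.
      by rewrite linearB [E (_ *: _)]linearZ_LR /= E1 scaler0 subr0.
    rewrite e E1 Es => /(congr1 ( *%R^~ (ra_pole i))).
    rewrite mul0r mulrDl -mulrA [(_ - _) * _]mulrC e mulr1 => /eqP.
    by rewrite eq_sym addr_eq0 => /eqP ->; rewrite [in RHS]mulrAC.
  by rewrite /P (inv D DM D1) (inv _ ra_derivM d1) /= dt mulr1 mulrN mulrC.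
have /asboolP gen_g := valP g.
suff /asboolP[h /val_inj <- //] : ra_val g \in
    [pred f | `[< exists2 h : Ra, ra_val h = f & P h >]] by [].
apply: gen_g.
- split.
  + by apply/asboolP; exists 1.
  + move=> c u v /asboolP[h <- Ph] /asboolP[k <- Pk]; apply/asboolP.
    by exists (c *: h + k); last exact: PD.
  + move=> u v /asboolP[h <- Ph] /asboolP[k <- Pk]; apply/asboolP.
    by exists (h * k); last exact: PM.
- move=> x [->|[i ->]]; apply/asboolP.
  + by exists ra_t.
  + by exists (ra_pole i).
Qed.

(* f : witt stands for the derivation f d/dt; by ra_derivation these are all the
   derivations of Ra. *)
Definition witt : Type := Ra.
HB.instance Definition _ := GRing.Lmodule.on witt.

Definition witt_bracket (f g : witt) : witt :=
  (f : Ra) * ra_deriv g - (g : Ra) * ra_deriv f.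

Fact witt_bracket_linearl g : linear (witt_bracket^~ g).
Proof. exact: (der_bracket_linearl (@ra_deriv : {linear Ra -> Ra})). Qed.
Fact witt_bracket_linearr f : linear (witt_bracket f).
Proof. exact: (der_bracket_linearr (@ra_deriv : {linear Ra -> Ra})). Qed.
Fact witt_bracketxx f : witt_bracket f f = 0.
Proof. exact: subrr. Qed.
Fact witt_jacobi f g h : 
  witt_bracket f (witt_bracket g h) + witt_bracket g (witt_bracket h f)
    + witt_bracket h (witt_bracket f g) = 0.
Proof. exact: (der_jacobi (D := ra_deriv) ra_derivM). Qed.

HB.instance Definition _ := Lmodule_isLie.Build F witt
  witt_bracket_linearl witt_bracket_linearr witt_bracketxx witt_jacobi.

(* The element (t - a_1)^m_1 ... (t - a_n)^m_n; by ra_monomial_mem and its instance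
   at - m it is a unit of Ra. *)
Definition ra_monomial (m : 'I_n -> int) : ratfun F :=
  \prod_(i < n) ratC ('X - (a i)%:P) ^ m i.

Lemma ra_monomial_mem m : ra_monomial m \in ra_pred.
Proof.
apply: rpred_prod => i _; case: (m i) => k.
- apply: rpredX; rewrite rmorphB /=; apply: rpredB; first exact: ra_t_subproof.
  have -> : ratC (a i)%:P = (a i)%:A :> ratfun F.
    by rewrite /GRing.scale /= /rat_scale mulr1.
  by apply: rpredZ; apply: rpred1.
- by rewrite NegzE -exprnN -exprVn rpredX // ra_pole_subproof.
Qed.

(* g : density alpha beta stands for g z; the parameters only select the action. *)
Definition density (alpha : 'I_n -> F) (beta : F) : Type := Ra.

Section Density.
Variables (alpha : 'I_n -> F) (beta : F).

Local Notation V := (density alpha beta).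

HB.instance Definition _ := GRing.Lmodule.on V.

Definition density_deriv (g : V) : V :=
  ra_deriv g + (g : Ra) * \sum_(j < n) alpha j *: ra_pole j.

Definition density_deriv_image : {pred V} :=
  [pred v | `[< exists g : V, v = density_deriv g >]].

Definition density_act (f : witt) (g : V) : V :=
  (f : Ra) * density_deriv g + beta *: (ra_deriv f * g : Ra).

Fact density_act_linearl g : linear (density_act^~ g).
Proof. exact: (der_act_linearl (@ra_deriv : {linear Ra -> Ra})). Qed.
Fact density_act_linearr f : linear (density_act f).
Proof. exact: (der_act_linearr (@ra_deriv : {linear Ra -> Ra})). Qed.
Fact density_act_bracket f g v :
  density_act (lie_bracket f g) v
    = density_act f (density_act g v) - density_act g (density_act f v).
Proof. exact: (der_act_bracket (D := ra_deriv) ra_derivM). Qed.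

HB.instance Definition _ := Lmodule_isLieModule.Build F witt V
  density_act_linearl density_act_linearr density_act_bracket.

End Density.

Definition integral_weight (alpha : 'I_n -> F) :=
  forall i, exists m : int, alpha i = m%:~R.

End DensityModules.

Arguments density_deriv {F n a} alpha beta g.
Arguments density_deriv_image {F n} a alpha beta.

(* Main.v *)
From HB Require Import structures.
Require Import Defs.
From mathcomp Require Import all_boot all_order all_algebra.
From mathcomp Require Import boolp reals.
From mathcomp Require Import complex ring.

(** Write [nabla] for the connection [g |-> g' + g * sum_j alpha_j / (t - a_j)].
    For [f, g, h] in [R_a] the combination [X_(fh) X_g - X_f X_(hg) + X_(fh'g)] of
    vector fields acts on densities as multiplication by
    [beta (beta - 1) h' (f g' - f' g)], and such functions generate [R_a].  Hence for
    [beta <> 0, 1] a submodule is an ideal stable under the derivation, and [R_a]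
    has no proper nonzero ones.  For [beta = 0] the action is [f nabla g] and for
    [beta = 1] it is [nabla (f g)]; the ideals [{w | R_a w <= W}] and
    [{w | nabla (R_a w) <= W}] are again stable, so a nonzero submodule lies in
    [ker nabla] or is everything, respectively contains [im nabla].  Kernel and image are
    computed after multiplication by a monomial in the [t - a_i], which shifts
    [alpha] by integers to a nonresonant weight: then a function whose image under
    [nabla] has only simple poles, also at infinity, is constant. *)

Set Implicit Arguments.
Unset Strict Implicit.
Unset Printing Implicit Defensive.

Import GRing.Theory.
Local Open Scope ring_scope.

(** * Polynomials with prescribed roots *)

Section PolePolynomials.
Variables (F : fieldType) (n : nat) (a : 'I_n -> F).
Implicit Types (p q : {poly F}) (c : 'I_n -> F).

Definition pole_poly : {poly F} := \prod_(i < n) ('X - (a i)%:P).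

Definition copole_poly (i : 'I_n) : {poly F} :=
  \prod_(j < n | j != i) ('X - (a j)%:P).

(** The numerator of [sum_i c i / (t - a i)] over the common denominator [pole_poly]; its value at
    [a i] is the residue [c i] times the value of [copole_poly i]. *)
Definition residue_poly c : {poly F} := \sum_(i < n) c i *: copole_poly i.

Lemma pole_polyE i : pole_poly = ('X - (a i)%:P) * copole_poly i.
Proof. by rewrite /pole_poly (bigD1 i). Qed.

Lemma pole_poly_monic : pole_poly \is monic.
Proof. exact: monic_prod_XsubC. Qed.

Lemma size_pole_poly : size pole_poly = n.+1.
Proof. by rewrite size_prod_XsubC /index_enum -enumT size_enum_ord. Qed.

Lemma pole_poly_neq0 : pole_poly != 0.
Proof. exact: monic_neq0 pole_poly_monic. Qed.

Lemma horner_pole_poly i : pole_poly.[a i] = 0.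
Proof. by rewrite (pole_polyE i) hornerM hornerXsubC subrr mul0r. Qed.

Lemma horner_deriv_pole_poly i : pole_poly^`().[a i] = (copole_poly i).[a i].
Proof.
rewrite (pole_polyE i) derivM derivXsubC mul1r hornerD hornerM hornerXsubC subrr.
by rewrite mul0r addr0.
Qed.

Lemma horner_residue_poly c i : (residue_poly c).[a i] = c i * (copole_poly i).[a i].
Proof.
rewrite /residue_poly horner_sum (bigD1 i) //= hornerZ big1 ?addr0 // => j nij.
rewrite hornerZ /copole_poly (bigD1 i) 1?eq_sym //= hornerM hornerXsubC subrr.
by rewrite mul0r mulr0.
Qed.

Lemma copole_poly_monic i : copole_poly i \is monic.
Proof. by apply: monic_prod => j _; apply: monicXsubC. Qed.

Lemma size_copole_poly i : size (copole_poly i) = n.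
Proof.
have := size_pole_poly; rewrite (pole_polyE i) mulrC size_Mmonic ?monicXsubC //.
  by rewrite size_XsubC addn2 => -[].
exact: monic_neq0 (copole_poly_monic i).
Qed.

Lemma size_residue_poly c : (size (residue_poly c) <= n)%N.
Proof.
apply: (leq_trans (size_sum _ _ _)); apply/bigmax_leqP => i _.
by apply: (leq_trans (size_scale_leq _ _)); rewrite size_copole_poly.
Qed.

Lemma residue_poly_top c : (residue_poly c)`_n.-1 = \sum_(i < n) c i.
Proof.
rewrite coef_sum; apply: eq_bigr => i _; rewrite coefZ.
have := monicP (copole_poly_monic i).
by rewrite lead_coefE size_copole_poly => ->; rewrite mulr1.
Qed.

Lemma coefM_top p q k l :
  (size p <= k.+1)%N -> (size q <= l.+1)%N -> (p * q)`_(k + l) = p`_k * q`_l.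
Proof.
move=> sp sq; have kl : (k < (k + l).+1)%N by rewrite ltnS leq_addr.
rewrite coefM (bigD1 (Ordinal kl)) //= addKn big1 ?addr0 // => i nik.
have [ik|ki|ik] := ltngtP i k; last by rewrite -val_eqE /= ik eqxx in nik.
  rewrite [q`__]nth_default ?mulr0 //; apply: leq_trans sq _.
  by rewrite ltn_subRL ltn_add2r.
by rewrite [p`__]nth_default ?mul0r //; apply: leq_trans sp _.
Qed.

Hypothesis a_inj : injective a.

Lemma horner_copole_poly_neq0 i : (copole_poly i).[a i] != 0.
Proof.
rewrite horner_prod; apply/prodf_neq0 => j nji.
by rewrite hornerXsubC subr_eq0 eq_sym (inj_eq a_inj).
Qed.

Lemma residue_poly_inj c : residue_poly c = 0 -> forall i, c i = 0.
Proof.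
move=> c0 i; have /eqP := horner_residue_poly c i.
rewrite c0 horner0 eq_sym mulf_eq0 => /orP[/eqP //|].
by rewrite (negPf (horner_copole_poly_neq0 i)).
Qed.

Lemma pole_poly_dvdp p : (forall i, p.[a i] = 0) -> exists q, p = q * pole_poly.
Proof.
move=> pa; have [||q pE] := @uniq_roots_prod_XsubC _ p [seq a i | i <- enum 'I_n].
- by apply/allP=> _ /mapP[i _ ->]; rewrite rootE pa.
- by rewrite uniq_rootsE map_inj_uniq ?enum_uniq.
by exists q; rewrite pE big_map big_enum.
Qed.

Hypothesis char0 : [pchar F] =i pred0.

Lemma natr_char0 k : (k%:R == 0 :> F) = (k == 0%N).
Proof. by move/pcharf0P: char0; apply. Qed.

(* The hypothesis says that [p / pole_poly ^+ k.+1] is mapped by the connection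
   to something with at most simple poles. *)
Lemma pole_order_drop c p q k :
    (forall i, c i != k.+1%:R) ->
    p^`() * pole_poly - pole_poly^`() * p *+ k.+1 + p * residue_poly c
      = q * pole_poly ^+ k.+1 ->
  exists p1, p = p1 * pole_poly.
Proof.
move=> ck e; apply: pole_poly_dvdp => i.
(* At [a i] the term with the derivative of [p] and the right side vanish; what remains is [(c i -
   k.+1) * p.[a i]] times the nonzero value of [copole_poly i]. *)
have := congr1 (horner^~ (a i)) e.
rewrite !(hornerD, hornerN, hornerM, hornerMn, horner_exp) horner_pole_poly.
rewrite exprS !(mul0r, mulr0) horner_residue_poly horner_deriv_pole_poly add0r.
rewrite -mulr_natl => e1.
have : (c i - k.+1%:R) * ((copole_poly i).[a i] * p.[a i]) = 0 by rewrite -e1; ring.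
move/eqP; rewrite !mulf_eq0 subr_eq0 (negPf (ck i)).
by rewrite (negPf (horner_copole_poly_neq0 i)) => /eqP.
Qed.

(** If [p] has degree [e > 0], the coefficient of degree [e + n - 1] in the sum is [e + \sum_i c i]
    times the leading coefficient of [p]. The size bound makes it vanish, which the hypothesis on
    [\sum_i c i] excludes. In the proof [e] is [d.+1]. *)
Lemma degree_drop c p :
    (0 < n)%N -> (forall d, (0 < d)%N -> \sum_i c i != - d%:R) ->
    (size (p^`() * pole_poly + p * residue_poly c)%R <= n)%N ->
  (size p <= 1)%N.
Proof.
move=> n0 cd sz; rewrite leqNgt; apply/negP => sp.
have [d pd] : exists d, size p = d.+2 by exists (size p).-2; case: (size p) sp => [|[]].
have sp' : (size p^`() <= d.+1)%N.
  by rewrite -ltnS -pd lt_size_deriv // -size_poly_gt0 pd.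
have /eqP : (p^`() * pole_poly + p * residue_poly c)`_(d + n) = 0.
  by rewrite nth_default // (leq_trans sz) ?leq_addl.
have sP : (size pole_poly <= n.+1)%N by rewrite size_pole_poly.
have sS : (size (residue_poly c) <= n.-1.+1)%N by rewrite prednK ?size_residue_poly.
have -> : (p^`() * pole_poly + p * residue_poly c)`_(d + n)
    = (d.+1%:R + \sum_i c i) * p`_d.+1.
  have dn : (d + n)%N = (d.+1 + n.-1)%N by rewrite addSnnS prednK.
  rewrite coefD (coefM_top sp' sP) dn coefM_top ?pd //.
  have -> : pole_poly`_n = 1.
    by rewrite -(monicP pole_poly_monic) lead_coefE size_pole_poly.
  by rewrite residue_poly_top coef_deriv -mulr_natl; ring.
rewrite mulf_eq0 addrC addr_eq0 (negPf (cd _ _)) //=.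
by rewrite -[d.+1]/d.+2.-1 -pd -lead_coefE lead_coef_eq0 -size_poly_eq0 pd.
Qed.

End PolePolynomials.

(** * The algebra [R_a] *)

Section RaTheory.
Variables (F : fieldType) (n : nat) (a : 'I_n -> F).
Implicit Types (f g h : Ra a) (p q : {poly F}) (c alpha : 'I_n -> F) (m : 'I_n -> int).

Local Notation P := (pole_poly a).

Lemma ratC_inj : injective (@ratC F).
Proof. by move=> p q /eqP; rewrite -subr_eq0 -rmorphB ratC_eq0 subr_eq0 => /eqP. Qed.

Lemma ratC_scale (b : F) p : ratC (b *: p) = b *: ratC p.
Proof. by rewrite -mul_polyC rmorphM. Qed.

Lemma ratC_const (b : F) : ratC b%:P = b%:A.
Proof. by rewrite /GRing.scale /= /rat_scale mulr1. Qed.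

Lemma ratC_pole_neq0 i : ratC ('X - (a i)%:P) != 0.
Proof. by rewrite ratC_eq0 polyXsubC_eq0. Qed.

Lemma ratC_pole_poly_neq0 : ratC P != 0.
Proof. by rewrite ratC_eq0 pole_poly_neq0. Qed.

Lemma ra_valM f g : ra_val (f * g) = ra_val f * ra_val g.
Proof. by []. Qed.

Lemma ra_valD f g : ra_val (f + g) = ra_val f + ra_val g.
Proof. by []. Qed.

Lemma ra_valZ (b : F) f : ra_val (b *: f) = b *: ra_val f.
Proof. by []. Qed.

Lemma ra_val1 : ra_val (1 : Ra a) = 1.
Proof. by []. Qed.

Lemma ra_val_sum I (r : seq I) (f : I -> Ra a) :
  ra_val (\sum_(i <- r) f i) = \sum_(i <- r) ra_val (f i).
Proof. exact: (raddf_sum (val : Ra a -> ratfun F)). Qed.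

Lemma ra_val_inj : injective (@ra_val F n a).
Proof. exact: val_inj. Qed.

Lemma mem_ra_poly p : ratC p \in ra_pred a.
Proof.
elim/poly_ind: p => [|p b IH]; first by rewrite rmorph0 rpred0.
rewrite rmorphD rmorphM /= rpredD //; first by rewrite rpredM // ra_t_subproof.
by rewrite ratC_const rpredZ ?rpred1.
Qed.

Definition ra_poly p : Ra a := MkRa (mem_ra_poly p).

Lemma ra_deriv_poly p : ra_deriv (ra_poly p) = ra_poly p^`().
Proof. by apply: ra_val_inj; rewrite /= rat_derivC. Qed.

Lemma ra_ind (S : Ra a -> Prop) :
    S 1 -> (forall (b : F) f g, S f -> S g -> S (b *: f + g)) ->
    (forall f g, S f -> S g -> S (f * g)) ->
    S (ra_t a) -> (forall i, S (ra_pole a i)) ->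
  forall f, S f.
Proof.
move=> S1 SD SM St Sp f; have /asboolP gen_f := valP f.
(* Membership in [alg_gen] is tested against subalgebras of [ratfun F], whereas [S] lives on [Ra a];
   the test subalgebra consists of the functions with a lift satisfying [S]. *)
suff /asboolP[h /ra_val_inj <- //] : ra_val f \in
    [pred f | `[< exists2 h : Ra a, ra_val h = f & S h >]] by [].
apply: gen_f; first split.
- by apply/asboolP; exists 1.
- move=> b u v /asboolP[h <- Ph] /asboolP[k <- Pk]; apply/asboolP.
  by exists (b *: h + k); last exact: SD.
- move=> u v /asboolP[h <- Ph] /asboolP[k <- Pk]; apply/asboolP.
  by exists (h * k); last exact: SM.
- by move=> x [->|[i ->]]; apply/asboolP; [exists (ra_t a) | exists (ra_pole a i)].
Qed.

Lemma ra_denom f : exists k p, ra_val f * ratC (P ^+ k) = ratC p.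
Proof.
elim/ra_ind: f => [|b f g [k [p fp]] [l [q gq]]|f g [k [p fp]] [l [q gq]]||i].
- by exists 0%N, 1; rewrite expr0 ra_val1 mul1r.
- exists (k + l)%N, (b *: (p * P ^+ l) + q * P ^+ k).
  rewrite ra_valD ra_valZ rmorphD /= ratC_scale exprD !rmorphM /= -fp -gq.
  rewrite mulrDl -!scalerAl.
  by congr (_ *: _ + _); rewrite ?mulrA // mulrAC.
- by exists (k + l)%N, (p * q); rewrite exprD !rmorphM /= -fp -gq mulrACA.
- by exists 0%N, 'X; rewrite expr0 rmorph1 mulr1.
- exists 1%N, (copole_poly a i).
  by rewrite expr1 (pole_polyE a i) rmorphM /= mulrA mulVf ?mul1r ?ratC_pole_neq0.
Qed.

(** Clearing denominators puts a nonzero polynomial into [J]. Differentiation lowers its degree and,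
    in characteristic zero, reaches a nonzero constant before it reaches [0]; a nonzero constant is
    a unit. *)
Lemma ra_ideal_full (J : Ra a -> Prop) (char0 : [pchar F] =i pred0) :
    (forall f g, J f -> J (g * f)) -> (forall f, J f -> J (ra_deriv f)) ->
    (exists2 f, J f & f != 0) ->
  forall f, J f.
Proof.
move=> JM JD [f Jf f0].
suff J1 : J 1 by move=> g; rewrite -[g]mulr1; apply: JM.
have [k [p fp]] := ra_denom f.
have Jp : J (ra_poly p).
  suff -> : ra_poly p = ra_poly (P ^+ k) * f by apply: JM.
  by apply: ra_val_inj; rewrite /= -fp mulrC.
have p0 : p != 0.
  have Pk : ratC (P ^+ k) != 0 by rewrite ratC_eq0 expf_neq0 ?pole_poly_neq0.
  have vf : ra_val f != 0 by apply: contraNneq f0 => f0; apply/eqP/ra_val_inj.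
  by apply: contraTneq (mulf_neq0 vf Pk) => p0; rewrite fp p0 rmorph0 eqxx.
have [s sp] := ubnP (size p); elim: s p sp Jp p0 {fp} => // s IH p sp Jp p0.
have [p'0|p'0] := eqVneq p^`() 0; last first.
  apply: IH p'0; last by rewrite -ra_deriv_poly; apply: JD.
  by rewrite (leq_trans (lt_size_deriv p0)).
have sp1 : (size p <= 1)%N.
  rewrite leqNgt; apply/negP => sp1.
  move/(congr1 (fun r : {poly F} => r`_(size p).-2))/eqP: p'0.
  rewrite coef_deriv coef0 -mulr_natr mulf_eq0 natr_char0 // orbF.
  have -> : (size p).-2.+1 = (size p).-1 by case: (size p) sp1 => [|[]].
  by rewrite -lead_coefE lead_coef_eq0 (negPf p0).
move: p0 Jp; rewrite (size1_polyC sp1) polyC_eq0 => b0 Jb.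
suff -> : 1 = ra_poly (p`_0)^-1%:P * ra_poly (p`_0)%:P by apply: JM.
by apply: ra_val_inj; rewrite ra_valM -[RHS]rmorphM -polyCM mulVf // [RHS]rmorph1.
Qed.

End RaTheory.

(** * The connection and its resonances *)

(** To be read with [x = g], [w = P ^+ k], [y = p], [u = P], [s] the weight form and [r] its
    numerator: the connection applied to [p / P ^+ k], freed of denominators. *)
Lemma denominator_identity (K : fieldType) (x dx s u du w dw y dy r q : K) (k : nat) :
    x * w = y -> dx * w + x * dw = dy -> dw * u = du * w *+ k -> s * u = r ->
    (dx + x * s) * u = q ->
  dy * u - du * y *+ k + y * r = q * w.
Proof.
move=> <- <- dwE <- <-.
have -> : (dx * w + x * dw) * u = dx * w * u + x * (dw * u) by ring.
by rewrite dwE -mulr_natl -[in X in - X]mulr_natl; ring.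
Qed.

Lemma log_derivative (K : fieldType) (D : K -> K) (x : K) (m : int) :
    (forall f g, D (f * g) = D f * g + f * D g) -> x != 0 ->
  D (x ^ m) = x ^ m * x^-1 * D x *~ m.
Proof.
move=> DM x0.
have D1 : D 1 = 0.
  by apply: (addIr (D 1)); rewrite add0r -[in RHS](mulr1 1) DM mulr1 mul1r.
elim/int_rect: m => [|k IH|k IH]; first by rewrite expr0z mulr0z.
  have xk : x ^ k.+1%:Z = x ^ k%:Z * x by rewrite -!exprnP exprSr.
  by rewrite xk DM IH -mulrzr -[RHS]mulrzr -!pmulrn -natr1; field.
(* Downward step: the product rule for this factorization is solved for the derivative of the power
   with exponent [- k.+1]. *)
have xk : x ^ (- k%:Z) = x ^ (- k.+1%:Z) * x.
  by rewrite -[X in _ * X]expr1z -expfzDr //; congr (_ ^ _); rewrite -addn1 PoszD opprD addrNK.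
apply: (mulIf x0); apply: (addIr (x ^ (- k.+1%:Z) * D x)).
by rewrite -DM -xk IH xk -mulrzr -[in RHS]mulrzr !mulrNz -!pmulrn -natr1; field.
Qed.

Section Connection.
Variables (F : fieldType) (n : nat) (a : 'I_n -> F).
Implicit Types (f g h : Ra a) (p q : {poly F}) (c alpha : 'I_n -> F) (m : 'I_n -> int).

Local Notation P := (pole_poly a).

Definition weight_form alpha : Ra a := \sum_(j < n) alpha j *: ra_pole a j.

(** The map [density_deriv] taken on the ring [Ra a] itself, where products are available and the
    weight can be changed. *)
Definition nabla alpha g : Ra a := ra_deriv g + g * weight_form alpha.

Fact nabla_linear alpha : linear (nabla alpha).
Proof.
move=> b f g; rewrite /nabla linearP /= mulrDl -scalerAl scalerDr.
by rewrite -!addrA; congr (_ + _); rewrite addrCA.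
Qed.

HB.instance Definition _ alpha :=
  GRing.isLinear.Build F (Ra a) (Ra a) *:%R (nabla alpha) (nabla_linear alpha).

Lemma nablaM alpha f g : nabla alpha (f * g) = ra_deriv f * g + f * nabla alpha g.
Proof. by rewrite /nabla ra_derivM mulrDr mulrA addrA. Qed.

Lemma nabla_eq alpha alpha' : alpha =1 alpha' -> nabla alpha =1 nabla alpha'.
Proof.
by move=> e g; rewrite /nabla /weight_form; under eq_bigr do rewrite e.
Qed.

Lemma nabla0 alpha : (forall i, alpha i = 0) -> nabla alpha =1 @ra_deriv F n a.
Proof.
by move=> z g; rewrite /nabla /weight_form big1 ?mulr0 ?addr0 // => i _; rewrite z scale0r.
Qed.

Lemma weight_form_pole_poly c : ra_val (weight_form c) * ratC P = ratC (residue_poly a c).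
Proof.
rewrite ra_val_sum mulr_suml rmorph_sum; apply: eq_bigr => i _.
rewrite ra_valZ -scalerAl [RHS]ratC_scale; congr (_ *: _).
by rewrite (pole_polyE a i) rmorphM /= mulKf ?ratC_pole_neq0.
Qed.

(** An exponent [k.+1] yields the hypothesis of [pole_order_drop], the exponent [0] the polynomial
    bounded in [degree_drop]. *)
Lemma nabla_denom alpha g p q k :
    ra_val g * ratC (P ^+ k) = ratC p -> ra_val (nabla alpha g) * ratC P = ratC q ->
  p^`() * P - P^`() * p *+ k + p * residue_poly a alpha = q * P ^+ k.
Proof.
move=> gp gq; apply: ratC_inj.
have Pk0 : P ^+ k != 0 by rewrite expf_neq0 ?pole_poly_neq0.
have dw : ratC (P ^+ k)^`() * ratC P = ratC P^`() * ratC (P ^+ k) *+ k.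
  rewrite -!rmorphM -rmorphMn /= deriv_exp; congr ratC.
  by case: (k) => [|l]; rewrite ?mulr0n ?mul0r // mulrnAl -mulrA -exprSr.
have := denominator_identity gp (rat_derivP Pk0 gp) dw (weight_form_pole_poly alpha) gq.
move=> e; rewrite rmorphD rmorphB rmorphMn !rmorphM; exact: e.
Qed.

Lemma ra_poly_const (b : F) : ra_poly a b%:P = b%:A.
Proof. by apply: ra_val_inj; rewrite ra_valZ; exact: ratC_const. Qed.

(** The indicial conditions. On a pole of order [k.+1] at [a i] the connection multiplies the
    leading coefficient by [c i - k.+1], on the top term of a polynomial of degree [d] by
    [\sum_i c i + d]; neither factor may vanish. *)
Definition nonresonant c :=
  (forall i k, c i != k.+1%:R) /\ (forall d, (0 < d)%N -> \sum_i c i != - d%:R).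

Hypothesis a_inj : injective a.
Hypothesis char0 : [pchar F] =i pred0.

Lemma nabla_simple_poles c g q :
    (forall i k, c i != k.+1%:R) -> ra_val (nabla c g) * ratC P = ratC q ->
  exists p, ra_val g = ratC p.
Proof.
move=> ck gq; have [k [p gp]] := ra_denom g.
elim: k p gp => [|k IH] p gp; first by exists p; rewrite -gp expr0 rmorph1 mulr1.
have [p1 pE] := pole_order_drop a_inj (ck^~ k) (nabla_denom gp gq).
apply: (IH p1); apply: (mulIf (ratC_pole_poly_neq0 a)).
by rewrite -mulrA -[in LHS]rmorphM -exprSr gp pE rmorphM.
Qed.

(** Finite poles are removed first, then positive degree. The case [q = 0] will give the kernel,
    nonzero [q] the obstruction to surjectivity. *)
Lemma nabla_nonresonant c g q : (0 < n)%N -> nonresonant c ->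
    ra_val (nabla c g) * ratC P = ratC q -> (size q <= n)%N ->
  exists2 b, g = b%:A & q = b *: residue_poly a c.
Proof.
move=> n0 [ck cd] gq sq; have [p gp] := nabla_simple_poles ck gq.
have gp0 : ra_val g * ratC (P ^+ 0) = ratC p by rewrite expr0 rmorph1 mulr1.
have := nabla_denom gp0 gq; rewrite mulr0n subr0 expr0 mulr1 => e.
have := @degree_drop _ _ a c p n0 cd; rewrite e => /(_ sq) sp.
have pE := size1_polyC sp; exists p`_0.
  by apply: ra_val_inj; rewrite -ra_poly_const gp [in LHS]pE.
by rewrite -e pE derivC mul0r add0r coefC eqxx mul_polyC.
Qed.

(** First [m0] moves the integral entries to [0]; the others never equal an integer. If the new sum
    is an integer [z] and some entry [i0] of [alpha] is not integral, shifting that entry by [- z]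
    as well makes the sum [0]. *)
Lemma nonresonant_shift alpha : exists m,
  nonresonant (fun i => alpha i + (m i)%:~R) /\
  (integral_weight alpha -> forall i, alpha i + (m i)%:~R = 0).
Proof.
pose isint (x : F) := exists z : int, x = z%:~R.
have [m0 m0P] : {m0 : 'I_n -> int & forall i, alpha i + (m0 i)%:~R = 0 \/
    ~ isint (alpha i) /\ m0 i = 0}.
  apply: (@choice _ _ (fun i z => alpha i + z%:~R = 0 \/ ~ isint (alpha i) /\ z = 0)) => i.
  have [[z zE]|ni] := pselect (isint (alpha i)).
    by exists (- z); left; rewrite zE mulrNz subrr.
  by exists 0; right; split.
have intD (x : F) (z : int) : isint (x + z%:~R) -> isint x.
  by case=> z' e; exists (z' - z); rewrite mulrzBr -e addrK.
pose c i := alpha i + (m0 i)%:~R.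
have [[z zE]|nz] := pselect (isint (\sum_i c i)); last first.
  exists m0; split; last first.
    by move=> ia i; case: (m0P i) => // -[] /(_ (ia i)).
  split.
    move=> i k; apply/eqP; case: (m0P i) => [->|[ni _] e].
      by apply/eqP; rewrite eq_sym natr_char0.
    by apply: ni; apply: (intD _ (m0 i)); rewrite e; exists k.+1%:Z.
  by move=> d _; apply/eqP => e; apply: nz; exists (- d%:Z); rewrite mulrNz -e.
have sum_ok (s : F) d : s = 0 -> (0 < d)%N -> s != - d%:R.
  by move=> -> d0; rewrite eq_sym oppr_eq0 natr_char0 // -lt0n.
have [ia|/existsNP[i0 ni0]] := pselect (integral_weight alpha).
  have c0 i : alpha i + (m0 i)%:~R = 0 by case: (m0P i) => // -[] /(_ (ia i)).
  exists m0; split=> //; split.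
    by move=> i k; rewrite c0 eq_sym natr_char0.
  by move=> d; apply: sum_ok; rewrite big1.
exists (fun i => m0 i - (i == i0)%:Z * z); split; last by move=> /(_ i0).
split.
  move=> i k; apply/eqP => e; case: (m0P i) => [e0|[ni _]]; last first.
    by apply: ni; apply: (intD _ (m0 i - (i == i0)%:Z * z)); rewrite e; exists k.+1%:Z.
  have [ii|ii] := eqVneq i i0.
    by apply: ni0; rewrite -ii; apply: (intD _ (m0 i)); rewrite e0; exists 0.
  move/eqP: e; rewrite (negPf ii) mul0r subr0 e0 eq_sym natr_char0 //.
move=> d; apply: sum_ok; under eq_bigr do rewrite mulrzBr addrA.
rewrite sumrB zE (bigD1 i0) //= eqxx mul1r big1 ?addr0 ?subrr // => i /negPf ->.
by rewrite mul0r.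
Qed.

Definition ra_mono m : Ra a := MkRa (ra_monomial_mem a m).

Lemma ra_mono_mulV m : ra_mono m * ra_mono (fun i => - m i) = 1.
Proof.
apply: ra_val_inj; rewrite ra_valM /= /ra_monomial -big_split big1 //= => i _.
by rewrite -expfzDr ?ratC_pole_neq0 // subrr expr0z.
Qed.

Lemma ra_deriv_mono m :
  ra_deriv (ra_mono m) = ra_mono m * weight_form (fun i => (m i)%:~R).
Proof.
apply: ra_val_inj; rewrite ra_valM ra_val_sum /= /ra_monomial.
(* The relation [x' = x * s] is multiplicative in [x] and additive in [s], so one factor at a time
   suffices. *)
apply: (big_ind2 (fun x s : ratfun F => rat_deriv x = x * s)).
- by rewrite -(rmorph1 (@ratC F)) rat_derivC derivC rmorph0 mulr0.
- by move=> x s y r xs yr; rewrite rat_derivM xs yr mulrDr mulrAC mulrA.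
move=> i _; rewrite log_derivative ?ratC_pole_neq0 //; last exact: rat_derivM.
by rewrite rat_derivC derivXsubC rmorph1 mulr1 scaler_int mulrzAr.
Qed.

(** A gauge transformation: multiplication by the unit [ra_mono a m] conjugates the connection of
    the shifted weight into that of [alpha]. *)
Lemma nabla_mono alpha m g :
  nabla alpha (g * ra_mono m) = nabla (fun i => alpha i + (m i)%:~R) g * ra_mono m.
Proof.
rewrite nablaM mulrDl; congr (_ + _); rewrite -mulrA; congr (_ * _).
rewrite /nabla ra_deriv_mono -mulrDr mulrC; congr (_ * _).
by rewrite addrC -big_split; apply: eq_bigr => i _; rewrite scalerDl.
Qed.

End Connection.

(** * Kernel and cokernel of the connection *)

Section KernelCokernel.
Variables (F : fieldType) (n : nat) (a : 'I_n -> F).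
Implicit Types (f g h : Ra a) (p q : {poly F}) (c alpha : 'I_n -> F) (m : 'I_n -> int).

Local Notation P := (pole_poly a).
Local Notation t := (ra_t a).
Local Notation pole := (ra_pole a).

Lemma ra_mono_Vmul m : ra_mono a (fun i => - m i) * ra_mono a m = 1.
Proof. by rewrite mulrC ra_mono_mulV. Qed.

Lemma ra_mono_neq0 m : ra_mono a m != 0.
Proof.
by apply/negP => /eqP m0; have := ra_mono_mulV a m; rewrite m0 mul0r => /eqP;
  rewrite eq_sym oner_eq0.
Qed.

Lemma ra_mono_inj m f g : f * ra_mono a m = g * ra_mono a m -> f = g.
Proof.
move/(congr1 ( *%R^~ (ra_mono a (fun i => - m i)))).
by rewrite -!mulrA ra_mono_mulV !mulr1.
Qed.

Lemma mono_factor m g : exists f, g = f * ra_mono a m.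
Proof. by exists (g * ra_mono a (fun i => - m i)); rewrite -mulrA ra_mono_Vmul mulr1. Qed.

Lemma ra_deriv1 : ra_deriv (1 : Ra a) = 0.
Proof.
by apply: (addIr (ra_deriv 1)); rewrite add0r -[in RHS](mulr1 1) ra_derivM mulr1 mul1r.
Qed.

Lemma ra_deriv_t : ra_deriv t = 1.
Proof. by apply: ra_val_inj; rewrite /= rat_derivC derivX rmorph1. Qed.

Lemma ra_pole_mul i : pole i * (t - (a i)%:A) = 1.
Proof.
apply: ra_val_inj; rewrite ra_valM ra_val1.
suff -> : ra_val (t - (a i)%:A) = ratC ('X - (a i)%:P) by rewrite mulVf ?ratC_pole_neq0.
by rewrite rmorphB /= ratC_const.
Qed.

Lemma ra_t_pole i : t * pole i = 1 + a i *: pole i.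
Proof. by rewrite -(ra_pole_mul i) mulrBr -scalerAr mulr1 mulrC subrK. Qed.

Lemma ra_deriv_pole i : ra_deriv (pole i) = - (pole i ^+ 2).
Proof.
apply: ra_val_inj; rewrite /= rat_derivV rat_derivC derivXsubC rmorph1 mulN1r.
by rewrite -exprVn.
Qed.

Lemma ra_deriv_t_exp k : ra_deriv (t ^+ k.+1) = k.+1%:R *: t ^+ k.
Proof.
elim: k => [|k IH]; first by rewrite expr1 ra_deriv_t expr0 scale1r.
by rewrite exprS ra_derivM ra_deriv_t mul1r IH -scalerAr -exprS -[k.+2%:R]natr1 scalerDl
  scale1r addrC.
Qed.

Lemma ra_deriv_pole_exp i k : ra_deriv (pole i ^+ k) = - k%:R *: pole i ^+ k.+1.
Proof.
elim: k => [|k IH]; first by rewrite expr0 ra_deriv1 oppr0 scale0r.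
rewrite exprS ra_derivM ra_deriv_pole IH -scalerAr mulNr -exprD -exprS add2n.
by rewrite -[k.+1%:R]natr1 opprD scalerDl scaleN1r addrC.
Qed.

(** Partial fractions: the span of the powers of [t] and of the poles is stable under multiplication
    by each generator and contains [1], so it is all of [Ra a]. *)
Lemma ra_basis_ind (a_inj : injective a) (S : Ra a -> Prop) :
    (forall (b : F) f g, S f -> S g -> S (b *: f + g)) ->
    (forall k, S (t ^+ k)) -> (forall i k, S (pole i ^+ k.+1)) ->
  forall f, S f.
Proof.
move=> lS tS pS f.
pose lin (S : Ra a -> Prop) := forall (b : F) f g, S f -> S g -> S (b *: f + g).
(* [S0] is the span itself; the given [S] need not be stable under multiplication by the
   generators. *)
pose S0 f := forall S : Ra a -> Prop, lin S -> (forall k, S (t ^+ k)) ->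
  (forall i k, S (pole i ^+ k.+1)) -> S f.
have lS0 : lin S0.
  by move=> b g h Sg Sh S' lS' tS' pS'; apply: (lS'); [apply: Sg | apply: Sh].
have tS0 k : S0 (t ^+ k) by move=> S'.
have pS0 i k : S0 (pole i ^+ k.+1) by move=> S'.
have S0Z b g : S0 g -> S0 (b *: g).
  move=> Sg; have Sz : S0 0 by rewrite -(addNr g) -scaleN1r; apply: lS0.
  by rewrite -[_ *: _]addr0; apply: lS0.
have S0D g h : S0 g -> S0 h -> S0 (g + h).
  by move=> Sg Sh; rewrite -[g]scale1r; apply: lS0.
have S0B g h : S0 g -> S0 h -> S0 (g - h).
  by move=> Sg Sh; rewrite -scaleN1r; apply: S0D => //; apply: S0Z.
suff : forall g, S0 g -> S0 (f * g).
  by move=> /(_ 1 (tS0 0%N)); rewrite mulr1; apply.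
have mul_ind x : (forall k, S0 (x * t ^+ k)) -> (forall i k, S0 (x * pole i ^+ k.+1)) ->
    forall g, S0 g -> S0 (x * g).
  move=> xt xp g /(_ (fun y => S0 (x * y))); apply=> // b g1 g2 xg1 xg2.
  rewrite mulrDr -scalerAr; exact: lS0.
elim/ra_ind: f => [g|b f1 f2 S1 S2 g Sg|f1 f2 S1 S2 g Sg||i].
- by rewrite mul1r.
- by rewrite mulrDl -scalerAl; apply: lS0; [apply: S1 | apply: S2].
- by rewrite -mulrA; exact: (S1 _ (S2 _ Sg)).
- apply: mul_ind => [k|i k]; first by rewrite -exprS.
  rewrite exprS mulrA ra_t_pole mulrDl mul1r -scalerAl -exprS; apply: S0D; last exact: S0Z.
  by case: k => [|k]; [exact: (tS0 0%N) | exact: pS0].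
apply: mul_ind => [k|j k].
  elim: k => [|k IH]; first by rewrite mulr1; apply: (pS0 i 0%N).
  rewrite exprS mulrA [_ * t]mulrC ra_t_pole mulrDl mul1r -scalerAl.
  by apply: S0D; [exact: tS0 | exact: S0Z].
have [<-|nij] := eqVneq i j; first by rewrite -exprS.
have aij : a i - a j != 0 by rewrite subr_eq0 (inj_eq a_inj).
(* The partial fraction of two distinct simple poles, which lowers the total pole order by one. *)
have pij : pole i * pole j = (a i - a j)^-1 *: (pole i - pole j).
  apply: (can_inj (scalerK aij)); rewrite scalerKV // scalerBl.
  rewrite [X in X - _]scalerAl [X in _ - X]scalerAr.
  have <- : t * pole i - 1 = a i *: pole i by rewrite ra_t_pole addrC addKr.
  have <- : t * pole j - 1 = a j *: pole j by rewrite ra_t_pole addrC addKr.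
  rewrite mulrBl mulrBr mul1r mulr1 mulrA [pole i * t]mulrC opprB addrC addrA.
  by rewrite subrK.
elim: k => [|k IH].
  by rewrite expr1 pij; apply: S0Z; apply: S0B; [exact: (pS0 i 0%N) | exact: (pS0 j 0%N)].
by rewrite exprS mulrA pij -scalerAl mulrBl -exprS; apply: S0Z; apply: S0B.
Qed.

Lemma weight_form_linear (b : F) c c' :
  weight_form a (fun i => b * c i + c' i) = b *: weight_form a c + weight_form a c'.
Proof.
rewrite scaler_sumr -big_split; apply: eq_bigr => i _.
by rewrite scalerDl scalerA.
Qed.

Lemma weight_form_delta i : weight_form a (fun j => (j == i)%:R) = pole i.
Proof.
rewrite /weight_form (bigD1 i) //= eqxx scale1r big1 ?addr0 // => j /negPf ->.
by rewrite scale0r.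
Qed.

Hypothesis a_inj : injective a.
Hypothesis char0 : [pchar F] =i pred0.
Hypothesis n_gt0 : (0 < n)%N.

Lemma weight_form0 : weight_form a (fun _ => 0) = 0.
Proof. by rewrite /weight_form big1 // => i _; rewrite scale0r. Qed.

Lemma nonresonant0 : nonresonant (fun _ : 'I_n => 0 : F).
Proof.
split=> [i k|d d0]; first by rewrite eq_sym natr_char0.
by rewrite big1 // eq_sym oppr_eq0 natr_char0 // -lt0n.
Qed.

(** In characteristic zero every basis element except the simple poles has an antiderivative. *)
Lemma ra_mod_deriv f : exists c h, f = weight_form a c + ra_deriv h.
Proof.
elim/(ra_basis_ind a_inj): f => [b _ _ [c [h ->]] [c' [h' ->]]|k|i [|k]].
- exists (fun i => b * c i + c' i), (b *: h + h').
  by rewrite weight_form_linear linearP scalerDr /= addrACA.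
- exists (fun _ => 0), (k.+1%:R^-1 *: t ^+ k.+1).
  by rewrite weight_form0 add0r linearZ_LR /= ra_deriv_t_exp scalerK ?natr_char0.
- by exists (fun j => (j == i)%:R), 0; rewrite weight_form_delta linear0 addr0 expr1.
exists (fun _ => 0), ((- k.+1%:R)^-1 *: pole i ^+ k.+1).
by rewrite weight_form0 add0r linearZ_LR /= ra_deriv_pole_exp scalerK // oppr_eq0 natr_char0.
Qed.

(** Residues of a derivative vanish: weight [0] is nonresonant and its connection is the derivation,
    so simple poles force a constant [h]. *)
Lemma weight_form_deriv_inj c h : weight_form a c = ra_deriv h -> forall i, c i = 0.
Proof.
move=> ch; apply: (residue_poly_inj a_inj).
have nh : ra_val (nabla (fun _ => 0) h) * ratC P = ratC (residue_poly a c).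
  by rewrite nabla0 // -ch weight_form_pole_poly.
have [b _ ->] := nabla_nonresonant a_inj n_gt0 nonresonant0 nh (size_residue_poly a c).
rewrite /residue_poly big1 ?scaler0 // => i _; exact: scale0r.
Qed.

Lemma nonresonant_ker c f : nonresonant c -> nabla c f = 0 ->
  exists2 b, f = b%:A & b *: residue_poly a c = 0.
Proof.
move=> nr nf; have nf0 : ra_val (nabla c f) * ratC P = ratC 0.
  by rewrite nf mul0r rmorph0.
have sz : (size (0 : {poly F})%R <= n)%N by rewrite size_poly0.
by have [b fb] := nabla_nonresonant a_inj n_gt0 nr nf0 sz; exists b.
Qed.

(** After the shift a kernel element is a nonzero constant [b], so the shifted weight form vanishes
    and [alpha i = - m i]. *)
Lemma nabla_ker_integral alpha g : nabla alpha g = 0 -> g != 0 -> integral_weight alpha.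
Proof.
have [m [nr _]] := nonresonant_shift char0 alpha.
have [f ->] := mono_factor m g; rewrite nabla_mono => e nz.
have nf : nabla (fun i => alpha i + (m i)%:~R) f = 0.
  by apply: (@ra_mono_inj m); rewrite e mul0r.
have [b fb /eqP] := nonresonant_ker nr nf; rewrite scaler_eq0 => /orP[/eqP b0|/eqP r0].
  by move: nz; rewrite fb b0 scale0r mul0r eqxx.
move=> i; exists (- m i); have := residue_poly_inj a_inj r0 i.
by move/eqP; rewrite addr_eq0 mulrNz => /eqP.
Qed.

Lemma nabla_ker_mono m g :
  nabla (fun i => (m i)%:~R) g = 0 -> exists b, g = b *: ra_mono a (fun i => - m i).
Proof.
have [f ->] := mono_factor (fun i => - m i) g; rewrite nabla_mono => e.
have e0 : nabla (fun _ => 0) f = 0.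
  apply: (@ra_mono_inj (fun i => - m i)); rewrite mul0r -[RHS]e; congr (_ * _).
  by apply: nabla_eq => i; rewrite mulrNz subrr.
have [b -> _] := nonresonant_ker nonresonant0 e0.
by exists b; rewrite -scalerAl mul1r.
Qed.

Lemma nabla_ra_mono m : nabla (fun i => (m i)%:~R) (ra_mono a (fun i => - m i)) = 0.
Proof.
rewrite -[ra_mono _ _]mul1r nabla_mono (@nabla_eq _ _ _ _ (fun _ => 0)).
  by rewrite nabla0 // ra_deriv1 mul0r.
by move=> i; rewrite mulrNz subrr.
Qed.

(* A simple-pole form [q / P] with [size q <= n] can only come from a constant,
   whose image is proportional to the residue polynomial; it therefore misses
   [1 / P] or ['X / P] when [n >= 2], and [1 / P] when the weight is zero. *)
Lemma nabla_not_surj alpha : (2 <= n)%N \/ integral_weight alpha ->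
  exists h, forall g, nabla alpha g <> h.
Proof.
move=> hyp; apply/not_existsP => /= all_h.
have {all_h} surj h : exists g, nabla alpha g = h.
  by have := all_h h; apply: contra_notP => /forallNP.
have [m [nr mint]] := nonresonant_shift char0 alpha.
set beta := fun i => alpha i + (m i)%:~R in nr.
have P_unit : ra_poly a P * ra_mono a (fun _ => -1) = 1.
  apply: ra_val_inj; rewrite ra_valM /= rmorph_prod -big_split big1 //= => i _.
  by rewrite exprN1 mulfV ?ratC_pole_neq0.
(* The target is [q / P] times the monomial of exponent [m]; cancelling the monomial leaves a
   preimage of [q / P] at the nonresonant weight. *)
have line q : (size q <= n)%N -> exists b, q = b *: residue_poly a beta.
  move=> sq.
  have [g] := surj (ra_poly a q * ra_mono a (fun _ => -1) * ra_mono a m).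
  have [f ->] := mono_factor m g; rewrite nabla_mono => /ra_mono_inj e.
  have ef : ra_val (nabla beta f) * ratC P = ratC q.
    by rewrite -[ratC P]/(ra_val (ra_poly a P)) -ra_valM e -mulrA [X in _ * X]mulrC
      P_unit mulr1.
  by have [b _ qE] := nabla_nonresonant a_inj n_gt0 nr ef sq; exists b.
have [|b1 e1] := line 1; first by rewrite size_poly1.
case: hyp => [n2|/mint z]; last first.
  move/eqP: e1; rewrite /residue_poly big1 ?scaler0 ?oner_eq0 // => i _.
  by rewrite /beta z scale0r.
have [|bX eX] := line 'X; first by rewrite size_polyX.
have e := congr1 (fun p => b1 *: p) eX; rewrite scalerA mulrC -scalerA -e1 in e.
have b10 : b1 != 0 by apply: contra_eq_neq e1 => ->; rewrite scale0r oner_eq0.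
have := congr1 (fun p => size p) e.
rewrite size_scale // size_polyX alg_polyC => sz.
by have := size_polyC_leq1 bX; rewrite -sz.
Qed.

End KernelCokernel.

(** * Surjectivity of the connection for one pole and nonintegral weight *)

Section OnePole.
Variables (F : fieldType) (a : 'I_1 -> F) (alpha : 'I_1 -> F).
Hypothesis char0 : [pchar F] =i pred0.

(** In the basis of powers the connection is triangular, with coefficients [1 + s + k] and [s - k]
    that do not vanish because [s] is not an integer. *)
Lemma nabla_surj : ~ integral_weight alpha -> forall h : Ra a, exists g, nabla alpha g = h.
Proof.
move=> nint.
have a_inj : injective a by move=> i j _; rewrite (ord1 i) (ord1 j).
pose s := alpha 0.
have s_nint (z : int) : s + z%:~R != 0.
  rewrite addr_eq0 -mulrNz; apply/eqP => e; apply: nint => i.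
  by exists (- z); rewrite (ord1 i).
have formE : weight_form a alpha = s *: ra_pole a 0 by rewrite /weight_form big_ord1.
(* The factor [u] cancels the pole of the weight form, so [nabla] keeps [t ^ k * u] polynomial. *)
pose u := ra_t a - (a 0)%:A.
have du : nabla alpha u = (1 + s) *: 1.
  rewrite /nabla formE -scalerAr [u * _]mulrC ra_pole_mul linearB linearZ_LR /=.
  by rewrite ra_deriv1 scaler0 subr0 ra_deriv_t scalerDl scale1r.
(* For [k = 0] the truncated exponent [k.-1] is harmless, since its coefficient is [0]. *)
have nt k : nabla alpha (ra_t a ^+ k * u)
    = (1 + s + k%:R) *: ra_t a ^+ k - (a 0 * k%:R) *: ra_t a ^+ k.-1.
  elim: k => [|k IH].
    by rewrite expr0 mul1r du mulr0 scale0r subr0 addr0.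
  rewrite exprS -mulrA nablaM ra_deriv_t mul1r IH !mulrBr -!scalerAr mulr1 -!exprS -exprSr.
  have -> : (a 0 * k%:R) *: ra_t a ^+ k.-1.+1 = (a 0 * k%:R) *: ra_t a ^+ k.
    by case: k {IH} => [|k]; rewrite ?mulr0 ?scale0r.
  rewrite addrACA -opprD -natr1 /=.
  rewrite -{1}[ra_t a ^+ k.+1]scale1r -!scalerDl; congr (_ *: _ - _ *: _); ring.
have np k : nabla alpha (ra_pole a 0 ^+ k) = (s - k%:R) *: ra_pole a 0 ^+ k.+1.
  rewrite /nabla formE ra_deriv_pole_exp -scalerAr -exprSr addrC scalerDl.
  by rewrite scaleNr.
elim/(ra_basis_ind a_inj) => [b _ _ [f <-] [g <-]|k|i k].
- by exists (b *: f + g); rewrite linearP.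
- elim: k => [|k [g IH]].
    exists ((1 + s)^-1 *: u); rewrite linearZ_LR /= du scalerK //.
    by have := s_nint 1; rewrite addrC.
  have z : 1 + s + k.+1%:R != 0.
    by have := s_nint (1 + k.+1%:Z); rewrite intrD [1 + s]addrC addrA.
  exists ((1 + s + k.+1%:R)^-1 *: (ra_t a ^+ k.+1 * u + (a 0 * k.+1%:R) *: g)).
  by rewrite linearZ_LR linearD linearZ_LR /= IH nt /= subrK scalerK.
rewrite (ord1 i); have z : s - k%:R != 0 by have := s_nint (- k%:Z); rewrite mulrNz.
by exists ((s - k%:R)^-1 *: ra_pole a 0 ^+ k); rewrite linearZ_LR /= np scalerK.
Qed.

End OnePole.

(** * Submodules of the modules of densities *)

(** All terms that differentiate [v] cancel, so the combination acts by multiplication by a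
    function; this is what makes submodules ideals for [b] other than [0] and [1]. *)
Lemma der_act_quadratic (F : fieldType) (A : comAlgType F) (D : {linear A -> A})
    (DM : forall f g, D (f * g) = D f * g + f * D g) (s : A) (b : F) (f g h v : A) :
  der_act D s b (f * h) (der_act D s b g v) - der_act D s b f (der_act D s b (h * g) v)
    + der_act D s b (f * D h * g) v
  = (b * (b - 1)) *: (D h * (f * D g - D f * g) * v).
Proof.
have [l lE] := scale_mul A b.
rewrite -scalerA scalerBl scale1r.
by rewrite /der_act !(linearB, linearD, DM, linearZ) /= ?DM !lE; ring.
Qed.

(** * Linear bijections, dimensions and isomorphisms *)

Section LinearBijections.
Variables (F : fieldType).

Lemma bijective_inj_surj (S T : Type) (f : S -> T) :
  injective f -> (forall y, exists x, f x = y) -> bijective f.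
Proof.
by move=> f_inj /choice[g fg]; exists g => // x; apply: f_inj; rewrite fg.
Qed.

Lemma has_dim_rV (V : lmodType F) n (phi : {linear 'rV[F]_n -> V}) :
  injective phi -> (forall v, exists c, phi c = v) -> has_dim V n.
Proof.
move=> inj surj; have [g phiK gK] := bijective_inj_surj inj surj.
by constructor; exists g; [exact: (can2_linear phiK gK) | exists phi].
Qed.

Variables (L : lieAlgType F) (M N : lieModType L).

Lemma lie_isomorphic_inj_surj (phi : {linear M -> N}) :
    injective phi -> (forall y, exists x, phi x = y) ->
    (forall x v, phi (lie_act x v) = lie_act x (phi v)) ->
  lie_isomorphic M N.
Proof. by move=> inj surj phi_act; exists phi; split=> //; exact: bijective_inj_surj. Qed.

Section Inverse.
Variables (phi : {linear M -> N}) (psi : N -> M).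
Hypotheses (phiK : cancel phi psi) (psiK : cancel psi phi).

(* The unused cancellation proofs let the linear structure be inferred. *)
Definition linear_inverse (_ : cancel phi psi) (_ : cancel psi phi) : N -> M := psi.

HB.instance Definition _ := GRing.isLinear.Build F N M *:%R
  (linear_inverse phiK psiK) (can2_linear phiK psiK).

Lemma lie_isomorphic_inverse :
  (forall x v, phi (lie_act x v) = lie_act x (phi v)) -> lie_isomorphic N M.
Proof.
move=> phi_act; exists (linear_inverse phiK psiK); split; first by exists phi.
by move=> x v; apply: (can_inj phiK); rewrite phi_act /= !psiK.
Qed.
End Inverse.
End LinearBijections.

Lemma lie_isomorphic_sym (F : fieldType) (L : lieAlgType F) (M N : lieModType L) :
  lie_isomorphic M N -> lie_isomorphic N M.
Proof. by case=> phi [[psi phiK psiK] phi_act]; exact: lie_isomorphic_inverse phi_act. Qed.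

(** * Submodules for generic [beta], for [beta = 0] and for [beta = 1] *)

Section Submodules.
Variables (F : fieldType) (n : nat) (a alpha : 'I_n -> F).
Hypothesis a_inj : injective a.
Hypothesis char0 : [pchar F] =i pred0.
Hypothesis n_gt0 : (0 < n)%N.
Implicit Types f g h v w : Ra a.

Local Notation V beta := (density a alpha beta).

Lemma density_actE beta f g :
  lie_act (f : witt a) (g : V beta) = f * nabla alpha g + beta *: (ra_deriv f * g) :> Ra a.
Proof. by []. Qed.

Lemma density_act0 f g : lie_act (f : witt a) (g : V 0) = f * nabla alpha g :> Ra a.
Proof. by rewrite density_actE scale0r addr0. Qed.

Lemma density_act1 f g : lie_act (f : witt a) (g : V 1) = nabla alpha (f * g) :> Ra a.
Proof. by rewrite density_actE nablaM scale1r addrC. Qed.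

Lemma ra_deriv_nabla g : ra_deriv g = nabla alpha g - g * weight_form a alpha.
Proof. by rewrite /nabla addrK. Qed.

Section Generic.
Variables (beta : F) (W : lieSubmodule (V beta)).
Hypotheses (beta_neq0 : beta != 0) (beta_neq1 : beta != 1).

Let stab f := forall v, (v : V beta) \in W -> (f * v : V beta) \in W.

Lemma bracket_stab f g h : stab (ra_deriv h * (f * ra_deriv g - ra_deriv f * g)).
Proof.
move=> v Wv; have b0 : beta * (beta - 1) != 0 by rewrite mulf_neq0 // subr_eq0.
rewrite -[_ * v](scalerK b0) (@rpredZ _ (V beta) W) //.
rewrite -(der_act_quadratic (D := @ra_deriv F n a) (@ra_derivM F n a) (weight_form a alpha)).
apply: (@rpredD (V beta) W).
  by apply: (@rpredB (V beta) W); do 2 apply: (@lsub_act F (witt a) (V beta) W).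
exact: (@lsub_act F (witt a) (V beta) W).
Qed.

Lemma stab_scale (b : F) f : b != 0 -> stab (b *: f) -> stab f.
Proof.
move=> b0 sf v Wv; rewrite -[f](scalerK b0) -scalerAl.
by rewrite (@rpredZ _ (V beta) W) //; apply: sf.
Qed.

Lemma stab_full f : stab f.
Proof.
have two : (2 : F) != 0 by rewrite natr_char0.
have dt := ra_deriv_t a.
elim/ra_ind: f => [v Wv|b f g sf sg v Wv|f g sf sg v Wv||i].
- by rewrite mul1r.
- rewrite mulrDl -scalerAl.
  by apply: (@rpredD (V beta) W); [apply: (@rpredZ _ (V beta) W); apply: sf | apply: sg].
- by rewrite -mulrA; apply/sf/sg.
(* The choice [f = 1], [g = t ^ 2], [h = t] gives the function [2 t]. *)
- apply: (stab_scale two); have := @bracket_stab 1 (ra_t a ^+ 2) (ra_t a).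
  by rewrite dt ra_deriv1 mul0r subr0 !mul1r ra_deriv_t_exp expr1.
have two' : - (2 : F) != 0 by rewrite oppr_eq0.
apply: (stab_scale two').
(* With [f = t - a i], [g = 1 / (t - a i)] and [h = t] the function is [- 2 / (t - a i)]. *)
have := @bracket_stab (ra_t a - (a i)%:A) (ra_pole a i) (ra_t a).
have du : ra_deriv (ra_t a - (a i)%:A) = 1.
  by rewrite linearB linearZ_LR /= ra_deriv1 scaler0 subr0 dt.
rewrite dt du ra_deriv_pole !mul1r mulrN expr2 mulrA.
rewrite [(_ - _) * ra_pole a i]mulrC ra_pole_mul mul1r.
by rewrite -opprD scaleNr scaler_nat mulr2n.
Qed.

Lemma generic_submod_full : submod_nonzero W -> forall v, (v : V beta) \in W.
Proof.
move=> [w Ww w0]; apply: (ra_ideal_full char0) => [f g Wf|f Wf|]; last by exists w.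
  exact: stab_full.
rewrite ra_deriv_nabla; apply: (@rpredB (V beta) W); last by rewrite mulrC; exact: stab_full.
have -> : nabla alpha f = lie_act (1 : witt a) (f : V beta).
  by rewrite density_actE mul1r ra_deriv1 mul0r scaler0 addr0.
exact: lsub_act.
Qed.

End Generic.

(** Acting on [w] by all fields puts the ideal generated by [nabla w] into [W]. The largest ideal in
    [W] is stable under the derivation because [x f'] is [x * nabla f], the action of [x] on [f],
    minus a multiple of [f]. *)
Lemma submod0_full (W : lieSubmodule (V 0)) w :
  (w : V 0) \in W -> nabla alpha w != 0 -> forall v, (v : V 0) \in W.
Proof.
move=> Ww nw.
suff JW v x : (x * v : V 0) \in W by move=> v; rewrite -[v]mul1r; apply: JW.
pose J v := forall x, (x * v : V 0) \in W.
move: x; rewrite -/(J v); move: v.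
apply: (ra_ideal_full char0) => [f g Jf x|f Jf x|]; last first.
- by exists (nabla alpha w) => // x; rewrite -density_act0; apply: lsub_act.
- rewrite ra_deriv_nabla mulrBr; apply: (@rpredB (V 0) W).
    by rewrite -density_act0; apply: lsub_act; rewrite -[f]mul1r; apply: Jf.
  by rewrite [f * _]mulrC mulrA; apply: Jf.
by rewrite mulrA; apply: Jf.
Qed.

(** Here the ideal [J] contains [w] itself, since [x] sends [w] to [nabla (x w)]. For its stability,
    [nabla (x * nabla f)] is the action of [x] on [nabla f], which lies in [W]. *)
Lemma submod1_image (W : lieSubmodule (V 1)) :
  submod_nonzero W -> forall v, (nabla alpha v : V 1) \in W.
Proof.
move=> [w Ww w0].
suff JW v x : (nabla alpha (x * v) : V 1) \in W.
  by move=> v; rewrite -[v]mul1r; apply: JW.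
pose J v := forall x, (nabla alpha (x * v) : V 1) \in W.
move: x; rewrite -/(J v); move: v.
apply: (ra_ideal_full char0) => [f g Jf x|f Jf x|]; last first.
- by exists w => // x; rewrite -density_act1; apply: lsub_act.
- rewrite ra_deriv_nabla mulrBr linearB /=; apply: (@rpredB (V 1) W).
    by rewrite -density_act1; apply: lsub_act; rewrite -[f]mul1r; apply: Jf.
  by rewrite [f * _]mulrC mulrA; apply: Jf.
by rewrite mulrA; apply: Jf.
Qed.

Fact ker_submod_closed :
  submod_closed ([pred v | `[< nabla alpha v = 0 >]] : {pred V 0}).
Proof.
split; first by apply/asboolP; rewrite linear0.
by move=> b u v /asboolP u0 /asboolP v0; apply/asboolP; rewrite linearP /= u0 v0 scaler0 addr0.
Qed.

Fact ker_submod_act (x : witt a) (v : V 0) :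
  v \in ([pred v | `[< nabla alpha v = 0 >]] : {pred V 0}) ->
  lie_act x v \in ([pred v | `[< nabla alpha v = 0 >]] : {pred V 0}).
Proof.
by move=> /asboolP v0; apply/asboolP; rewrite density_act0 v0 mulr0 linear0.
Qed.

Definition ker_submod : lieSubmodule (V 0) :=
  LieSubmodule ker_submod_closed ker_submod_act.

Lemma mem_ker_submod (v : V 0) : v \in ker_submod <-> nabla alpha v = 0.
Proof. by split=> /asboolP. Qed.

Fact image_submod_closed : submod_closed (density_deriv_image a alpha 1).
Proof.
split; first by apply/asboolP; exists 0; exact: esym (linear0 (nabla alpha)).
move=> b u v /asboolP[f ->] /asboolP[g ->]; apply/asboolP; exists (b *: f + g).
exact: esym (linearP (nabla alpha) b f g).
Qed.

(** Every vector field maps the whole module into the image, which is also why the quotient will be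
    trivial. *)
Fact image_submod_act (x : witt a) (v : V 1) :
  v \in density_deriv_image a alpha 1 -> lie_act x v \in density_deriv_image a alpha 1.
Proof. by move=> _; apply/asboolP; exists ((x : Ra a) * v); exact: density_act1. Qed.

Definition image_submod : lieSubmodule (V 1) :=
  LieSubmodule image_submod_closed image_submod_act.

Lemma mem_image_submod (v : V 1) : v \in image_submod <-> exists g, nabla alpha g = v.
Proof.
split=> [/asboolP[g ->]|[g gv]]; first by exists g.
by apply/asboolP; exists g; rewrite -gv.
Qed.

Lemma nabla_neq0 : exists g, nabla alpha g != 0.
Proof.
have [/eqP n1|n1] := boolP (nabla alpha (1 : Ra a) == 0); last by exists 1.
(* If [nabla 1 = 0], then [nabla t = 1]. *)
exists (ra_t a * 1); rewrite nablaM n1 mulr0 addr0 mulr1 ra_deriv_t.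
exact: oner_neq0.
Qed.

Lemma image_submod_nonzero : submod_nonzero image_submod.
Proof.
by have [g g0] := nabla_neq0; exists (nabla alpha g) => //; apply/mem_image_submod; exists g.
Qed.

Lemma image_submod_smallest (W : lieSubmodule (V 1)) :
  submod_nonzero W -> {subset image_submod <= W}.
Proof. by move=> Wnz v /mem_image_submod[g <-]; exact: submod1_image. Qed.

(** A nonzero submodule of [lie_submod W] has as image in [M] a nonzero submodule [I]; minimality
    gives that [I] contains [W], so it was not proper. *)
Lemma smallest_irreducible (L : lieAlgType F) (M : lieModType L) (W : lieSubmodule M) :
    submod_nonzero W ->
    (forall W' : lieSubmodule M, submod_nonzero W' -> {subset W <= W'}) ->
  lie_irreducible (lie_submod W).
Proof.
move=> [v Wv v0] Wmin; split.
  by exists (Submod Wv); apply: contra_neq v0 => /(congr1 (@submod_val _ _ _ _)).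
case=> W2 [[w W2w w0] [u nu]].
pose I : {pred M} := [pred x | `[< exists2 y : lie_submod W, y \in W2 & submod_val y = x >]].
have Icl : submod_closed I.
  split; first by apply/asboolP; exists 0; rewrite ?rpred0.
  move=> b _ _ /asboolP[y Wy <-] /asboolP[z Wz <-]; apply/asboolP.
  by exists (b *: y + z); rewrite ?rpredD ?rpredZ.
have Iact x y : y \in I -> lie_act x y \in I.
  move=> /asboolP[z Wz <-]; apply/asboolP; exists (lie_act x z) => //.
  exact: lsub_act.
have Inz : submod_nonzero (LieSubmodule Icl Iact).
  exists (submod_val w); first by apply/asboolP; exists w.
  by apply: contra_neq w0 => w0; apply: val_inj.
have /asboolP[y Wy yu] := Wmin _ Inz _ (valP u).
by move/negP: nu; apply; have <- : y = u by apply: val_inj.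
Qed.

(** Properness forces [W] into the kernel, which is a line, and a nonzero subspace of a line is the
    line. *)
Lemma submod0_eq_ker (m : 'I_n -> int) :
  (forall i, alpha i = (m i)%:~R) ->
  forall W : lieSubmodule (V 0), submod_nonzero W -> submod_proper W -> W =i ker_submod.
Proof.
move=> am W [w Ww w0] [u nu].
have Wker v : v \in W -> nabla alpha v = 0.
  move=> Wv; apply/eqP; apply: contraNT nu => nv; exact: (submod0_full Wv nv).
have line v : nabla alpha v = 0 -> exists b, v = b *: ra_mono a (fun i => - m i).
  by rewrite (nabla_eq am) => /(nabla_ker_mono a_inj char0 n_gt0).
move=> v; apply/idP/idP => [/Wker v0|/mem_ker_submod]; first exact/mem_ker_submod.
move/line => [b ->]; have [c wE] := line _ (Wker _ Ww).
have c0 : c != 0 by apply: contra_neq w0 => c0; rewrite wE c0 scale0r.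
have -> : ra_mono a (fun i => - m i) = c^-1 *: w by rewrite wE scalerK.
by do 2 apply: (@rpredZ _ (V 0) W).
Qed.

Lemma mono_ker_submod (m : 'I_n -> int) : (forall i, alpha i = (m i)%:~R) ->
  (ra_mono a (fun i => - m i) : V 0) \in ker_submod.
Proof. by move=> am; apply/mem_ker_submod; rewrite (nabla_eq am) nabla_ra_mono. Qed.

Lemma ker_submod_proper : submod_proper ker_submod.
Proof.
have [g g0] := nabla_neq0.
by exists g; apply/negP => /mem_ker_submod /eqP; rewrite (negPf g0).
Qed.

Section KernelLine.
Variables (m : 'I_n -> int) (am : forall i, alpha i = (m i)%:~R).

Definition ker_line (c : 'rV[F]_1) : lie_submod ker_submod :=
  c 0 0 *: Submod (mono_ker_submod am).

Fact ker_line_linear : linear ker_line.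
Proof. by move=> b c d; rewrite /ker_line !mxE scalerDl scalerA. Qed.

HB.instance Definition _ :=
  GRing.isLinear.Build F 'rV[F]_1 (lie_submod ker_submod) *:%R ker_line ker_line_linear.

Lemma ker_submod_dim : has_dim (lie_submod ker_submod) 1.
Proof.
apply: (@has_dim_rV _ _ _ ker_line) => [c d|v].
  move=> /(congr1 (@submod_val _ _ _ _)) /= /eqP; rewrite -subr_eq0 -scalerBl scaler_eq0.
  rewrite (negPf (ra_mono_neq0 _ _)) orbF subr_eq0 => /eqP cd.
  by apply/matrixP => i j; rewrite (ord1 i) (ord1 j).
have /mem_ker_submod := valP v; rewrite (nabla_eq am).
move=> /(nabla_ker_mono a_inj char0 n_gt0)[b vE].
by exists (const_mx b); apply: val_inj; rewrite /= mxE vE.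
Qed.

End KernelLine.

End Submodules.

(** * The image of the connection *)

Section LinSpan.
Variables (F : fieldType) (V : lmodType F) (X : V -> Prop).

Lemma lin_span_closed : submod_closed (lin_span X).
Proof.
split; first by apply/asboolP=> S [].
move=> c u v /asboolP Su /asboolP Sv; apply/asboolP=> S clS XS.
by case: (clS) => _ lS; apply: lS; [apply: Su | apply: Sv].
Qed.

HB.instance Definition _ := GRing.isSubmodClosed.Build F V (lin_span X) lin_span_closed.

Lemma mem_lin_span x : X x -> x \in lin_span X.
Proof. by move=> Xx; apply/asboolP=> S _; apply. Qed.

Lemma lin_span_ind (S : V -> Prop) :
    S 0 -> (forall (c : F) u v, S u -> S v -> S (c *: u + v)) -> (forall x, X x -> S x) ->
  forall v, v \in lin_span X -> S v.
Proof.
move=> S0 lS XS v /asboolP/(_ [pred v | `[< S v >]]) H; apply/asboolP; apply: H.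
  split; first exact/asboolP.
  by move=> c u w /asboolP Su /asboolP Sw; apply/asboolP/lS.
by move=> x /XS Sx; apply/asboolP.
Qed.
End LinSpan.

Section Derivatives.
Variables (F : fieldType) (n : nat) (a : 'I_n -> F).
Hypothesis a_inj : injective a.
Hypothesis char0 : [pchar F] =i pred0.
Hypothesis n_gt0 : (0 < n)%N.

Let poly_part : {pred ratfun F} := lin_span (fun f => exists k : nat, f = ratC 'X ^+ k).
Let polar_part : {pred ratfun F} :=
  lin_span (fun f => exists (i : 'I_n) (k : nat),
    (1 <= k)%N /\ f = ratC ('X - (a i)%:P) ^- k.+1).

Lemma ra_val_X (x : Ra a) k : ra_val (x ^+ k) = ra_val x ^+ k.
Proof. exact: (rmorphXn (val : Ra a -> ratfun F)). Qed.

Lemma ra_derivZ (b : F) (h : Ra a) : ra_deriv (b *: h) = b *: ra_deriv h.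
Proof. exact: linearZ_LR. Qed.

Lemma ra_deriv_parts (h : Ra a) :
  exists p q, [/\ p \in poly_part, q \in polar_part & ra_val (ra_deriv h) = p + q].
Proof.
elim/(ra_basis_ind a_inj): h => [b f g [p [q [pp pq fE]]] [p' [q' [pp' pq' gE]]]|k|i k].
- exists (b *: p + p'), (b *: q + q'); split; rewrite ?rpredD ?rpredZ //.
  by rewrite ra_deriv_linear ra_valD ra_valZ fE gE scalerDr addrACA.
- case: k => [|k].
    by exists 0, 0; rewrite !rpred0 ra_deriv1 addr0.
  exists (k.+1%:R *: ratC 'X ^+ k), 0; split; rewrite ?rpred0 //.
    by rewrite rpredZ // mem_lin_span //; exists k.
  by rewrite ra_deriv_t_exp ra_valZ ra_val_X addr0.
exists 0, (- k.+1%:R *: ratC ('X - (a i)%:P) ^- k.+2); split; rewrite ?rpred0 //.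
  by rewrite rpredZ // mem_lin_span //; exists i, k.+1.
by rewrite ra_deriv_pole_exp ra_valZ ra_val_X exprVn add0r.
Qed.

Lemma poly_part_deriv f : f \in poly_part -> exists h : Ra a, f = ra_val (ra_deriv h).
Proof.
move: f; apply: lin_span_ind => [|b u v [h ->] [h' ->]|_ [k ->]].
- by exists 0; rewrite linear0.
- by exists (b *: h + h'); rewrite linearP.
exists (k.+1%:R^-1 *: ra_t a ^+ k.+1).
by rewrite ra_derivZ ra_deriv_t_exp scalerK ?natr_char0 // ra_val_X.
Qed.

Lemma polar_part_deriv f : f \in polar_part -> exists h : Ra a, f = ra_val (ra_deriv h).
Proof.
move: f; apply: lin_span_ind => [|b u v [h ->] [h' ->]|_ [i [[|k] [// _ ->]]]].
- by exists 0; rewrite linear0.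
- by exists (b *: h + h'); rewrite linearP.
exists ((- k.+1%:R)^-1 *: ra_pole a i ^+ k.+1).
by rewrite ra_derivZ ra_deriv_pole_exp scalerK ?oppr_eq0 ?natr_char0 // ra_val_X exprVn.
Qed.

Lemma poly_part_poly f : f \in poly_part -> exists p, f = ratC p.
Proof.
move: f; apply: lin_span_ind => [|b u v [p ->] [q ->]|_ [k ->]].
- by exists 0; rewrite rmorph0.
- by exists (b *: p + q); rewrite rmorphD /= ratC_scale.
by exists ('X ^+ k); rewrite rmorphXn.
Qed.

(** Polar parts are proper fractions; a polynomial that is a proper fraction is [0], whence the
    directness of the sum. *)
Lemma polar_part_proper f : f \in polar_part ->
  exists p q : {poly F}, [/\ q != 0, (size p < size q)%N & f * ratC q = ratC p].
Proof.
move: f; apply: lin_span_ind => [|b u v [p [q [q0 spq up]]]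
  [p' [q' [q'0 spq' vp]]]|_ [i [k [_ ->]]]].
- by exists 0, 1; rewrite oner_neq0 size_poly0 size_poly1 mul0r rmorph0.
- exists (b *: (p * q') + p' * q), (q * q'); rewrite mulf_neq0 //; split=> //.
    have szM (r s t : {poly F}) : s != 0 -> t != 0 -> (size r < size s)%N ->
        (size (r * t)%R < size (s * t)%R)%N.
      move=> s0 t0 rs; have [->|r0] := eqVneq r 0.
        by rewrite mul0r size_poly0 size_poly_gt0 mulf_neq0.
      by rewrite !size_mul // (polySpred t0) !addnS /= ltn_add2r.
    apply: (leq_ltn_trans (size_polyD _ _)); rewrite gtn_max.
    rewrite (leq_ltn_trans (size_scale_leq _ _)) /=; last exact: szM.
    by rewrite [q * q']mulrC szM.
  rewrite rmorphD /= ratC_scale !rmorphM /= -up -vp mulrDl -!scalerAl !mulrA.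
  by congr (_ + _); rewrite mulrAC.
exists 1, (('X - (a i)%:P) ^+ k.+1); split.
- by rewrite expf_neq0 ?polyXsubC_eq0.
- by rewrite size_poly1 size_exp_XsubC.
by rewrite rmorphXn /= mulVf ?rmorph1 // expf_neq0 ?ratC_pole_neq0.
Qed.

Lemma parts_direct f : f \in poly_part -> f \in polar_part -> f = 0.
Proof.
move=> /poly_part_poly[p ->] /polar_part_proper[r [q [q0 srq e]]].
have {}e : p * q = r by apply: ratC_inj; rewrite -e rmorphM.
have [->|p0] := eqVneq p 0; first exact: rmorph0.
move: srq; rewrite -e size_mul // (polySpred p0) addSn /=.
by rewrite ltnNge leq_addl.
Qed.

Variables (alpha : 'I_n -> F) (m : 'I_n -> int) (am : forall i, alpha i = (m i)%:~R).

(** Under the identification of [z] with the monomial, the connection becomes the ordinary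
    derivation, so its image becomes the space of all derivatives. *)
Lemma nabla_mono_deriv (g : Ra a) : nabla alpha g * ra_mono a m = ra_deriv (g * ra_mono a m).
Proof.
rewrite -(@nabla0 _ _ _ (fun _ => 0)) // nabla_mono; congr (_ * _).
by apply: nabla_eq => i; rewrite add0r.
Qed.

Lemma image_submod_parts f :
  (exists2 g : density a alpha 1, g \in image_submod a alpha
     & f = ra_val g * ra_monomial a m) <->
  exists p q, [/\ p \in poly_part, q \in polar_part & f = p + q].
Proof.
split=> [[_ /mem_image_submod[g <-] ->]|[p [q [pp pq ->]]]].
  have -> : ra_val (nabla alpha g) * ra_monomial a m = ra_val (ra_deriv (g * ra_mono a m)).
    by rewrite -nabla_mono_deriv.
  exact: ra_deriv_parts.
have [h pE] := poly_part_deriv pp; have [k qE] := polar_part_deriv pq.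
have [g gE] := mono_factor m (h + k).
exists (nabla alpha g); first by apply/mem_image_submod; exists g.
rewrite -[ra_monomial a m]/(ra_val (ra_mono a m)) -ra_valM nabla_mono_deriv -gE linearD.
by rewrite ra_valD pE qE.
Qed.

(** The class with residues [c]; division by the monomial undoes the identification of [z]. *)
Definition coker_map (c : 'rV[F]_n) : lie_quot (image_submod a alpha) :=
  lie_quot_pi (image_submod a alpha)
    (weight_form a (c 0) * ra_mono a (fun i => - m i) : density a alpha 1).

Fact coker_map_linear : linear coker_map.
Proof.
move=> b c d; rewrite /coker_map -linearP /=; congr lie_quot_pi.
rewrite scalerAl -mulrDl -weight_form_linear; congr (_ * _).
by apply: eq_bigr => i _; rewrite !mxE.
Qed.

HB.instance Definition _ := GRing.isLinear.Build F 'rV[F]_n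
  (lie_quot (image_submod a alpha)) *:%R coker_map coker_map_linear.

(** Injectivity is the vanishing of residues of derivatives; surjectivity is reduction to simple
    poles modulo derivatives. *)
Lemma image_submod_codim : has_dim (lie_quot (image_submod a alpha)) n.
Proof.
apply: (@has_dim_rV _ _ _ coker_map).
  apply: raddf_inj => c; rewrite -(raddf0 (lie_quot_pi (image_submod a alpha))).
  move/lie_quot_eq; rewrite subr0 => /mem_image_submod[g].
  move/(congr1 ( *%R^~ (ra_mono a m))); rewrite nabla_mono_deriv -mulrA ra_mono_Vmul mulr1.
  move/esym/(weight_form_deriv_inj a_inj char0 n_gt0) => c0.
  by apply/rowP => i; rewrite c0 mxE.
elim/lie_quot_ind => v; have [c [h vE]] := ra_mod_deriv a_inj char0 (v * ra_mono a m).
exists (\row_i c i); apply/lie_quot_eq/mem_image_submod.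
(* The sign comes from the order of the difference: [coker_map] minus [v] must lie in the image. *)
have [g gE] := mono_factor m (- h); exists g.
apply: (@ra_mono_inj _ _ _ m); rewrite nabla_mono_deriv -gE mulrBl vE.
rewrite -mulrA ra_mono_Vmul mulr1.
have -> : weight_form a ((\row_i c i) 0) = weight_form a c.
  by apply: eq_bigr => i _; rewrite mxE.
by rewrite opprD addNKr linearN.
Qed.

End Derivatives.

(** * Reducibility criterion, trivial quotient and isomorphisms *)

Section Main.
Variables (F : fieldType) (n : nat) (a alpha : 'I_n -> F).
Hypothesis a_inj : injective a.
Hypothesis char0 : [pchar F] =i pred0.
Hypothesis n_gt0 : (0 < n)%N.

(** This criterion decides reducibility at [beta = 1], the vanishing of the quotient and the
    isomorphism between weights [0] and [1]. *)
Lemma nabla_surjP : (forall h : Ra a, exists g, nabla alpha g = h) <->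
  n = 1%N /\ ~ integral_weight alpha.
Proof.
split=> [surj|].
  have H : ~ ((2 <= n)%N \/ integral_weight alpha).
    by move=> /(nabla_not_surj a_inj char0 n_gt0)[h nh]; have [g /nh] := surj h.
  split; last by move=> ia; apply: H; right.
  by apply/eqP; rewrite eqn_leq n_gt0 andbT leqNgt; apply/negP => n2; apply: H; left.
case=> n1; move: a alpha; rewrite n1 => a' alpha'; exact: nabla_surj.
Qed.

Lemma nabla_inj : ~ integral_weight alpha -> injective (nabla (a := a) alpha).
Proof.
move=> nint; apply: raddf_inj => g g0; apply: contra_notP nint => /eqP nz.
by have := nabla_ker_integral a_inj char0 n_gt0 g0 nz.
Qed.

Lemma image_submod_properP :
  submod_proper (image_submod a alpha) <-> (2 <= n)%N \/ integral_weight alpha.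
Proof.
split=> [[v nv]|/(nabla_not_surj a_inj char0 n_gt0)[h nh]]; last first.
  by exists h; apply/negP => /mem_image_submod[g]; exact: nh.
apply: contrapT => H; move/negP: nv; apply; apply/mem_image_submod.
apply: nabla_surjP.2 v; split; last by move=> ia; apply: H; right.
by apply/eqP; rewrite eqn_leq n_gt0 andbT leqNgt; apply/negP => n2; apply: H; left.
Qed.

(** For [beta = 0] a nonzero vector of a proper submodule lies in the kernel, so [alpha] is
    integral; for [beta = 1] a proper submodule contains the image, which is then proper; for other
    [beta] every nonzero submodule is full. Conversely the kernel and the image serve as
    witnesses. *)
Lemma density_reducibleP beta : lie_reducible (density a alpha beta) <->
  [\/ beta = 0 /\ integral_weight alpha, beta = 1 /\ (2 <= n)%N
    | [/\ beta = 1, n = 1%N & integral_weight alpha]].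
Proof.
split.
  case=> W [Wnz [u nu]].
  have [b0|b0] := eqVneq beta 0.
    move: W Wnz u nu; rewrite b0 => W [w Ww w0] u nu; constructor 1; split=> //.
    apply: (nabla_ker_integral a_inj char0 n_gt0 _ w0); apply/eqP.
    by apply: contraNT nu => nw; exact: (submod0_full char0 Ww nw).
  have [b1|b1] := eqVneq beta 1; last first.
    by move/negP: nu => []; exact: generic_submod_full.
  move: W Wnz u nu; rewrite b1 => W Wnz u nu.
  have /image_submod_properP H : submod_proper (image_submod a alpha).
    exists u; apply: contraNN nu => Iu.
    exact: (image_submod_smallest char0 Wnz Iu).
  have [n2|n2] := leqP 2 n; first by constructor 2.
  case: H => [|ia]; first by rewrite leqNgt n2.
  by constructor 3; split=> //; apply/eqP; rewrite eqn_leq n_gt0 andbT -ltnS.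
case=> [[-> ia]|[-> n2]|[-> n1 ia]].
- have [m am] := choice ia; exists (ker_submod a alpha); split.
    exists (ra_mono a (fun i => - m i)); first exact: mono_ker_submod.
    exact: ra_mono_neq0.
  exact: ker_submod_proper.
- exists (image_submod a alpha); split; first exact: image_submod_nonzero.
  by apply/image_submod_properP; left.
exists (image_submod a alpha); split; first exact: image_submod_nonzero.
by apply/image_submod_properP; right.
Qed.

Lemma image_quot_trivial : lie_trivial (lie_quot (image_submod a alpha)).
Proof.
move=> x; elim/lie_quot_ind => v.
rewrite [LHS]lie_quot_act_pi -(raddf0 (lie_quot_pi (image_submod a alpha))).
apply/lie_quot_eq; rewrite subr0; apply/mem_image_submod; exists ((x : Ra a) * v).
by rewrite density_act1.
Qed.

Lemma image_quot_eq0P : (forall u : lie_quot (image_submod a alpha), u = 0) <->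
  n = 1%N /\ ~ integral_weight alpha.
Proof.
rewrite -nabla_surjP; split=> H.
  move=> h; have := H (lie_quot_pi (image_submod a alpha) h).
  rewrite -[RHS](raddf0 (lie_quot_pi (image_submod a alpha))).
  by move/lie_quot_eq; rewrite subr0 => /mem_image_submod.
elim/lie_quot_ind => v; rewrite -[RHS](raddf0 (lie_quot_pi (image_submod a alpha))).
by apply/lie_quot_eq; rewrite subr0; apply/mem_image_submod/H.
Qed.

Lemma mem_nabla_image (g : density a alpha 0) :
  (nabla alpha g : density a alpha 1) \in image_submod a alpha.
Proof. by apply/mem_image_submod; exists g. Qed.

Definition nabla_corestr (g : density a alpha 0) : lie_submod (image_submod a alpha) :=
  Submod (mem_nabla_image g).

Fact nabla_corestr_linear : linear nabla_corestr.
Proof. by move=> b f g; apply: val_inj; exact: (linearP (nabla alpha)). Qed.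

HB.instance Definition _ := GRing.isLinear.Build F (density a alpha 0)
  (lie_submod (image_submod a alpha)) *:%R nabla_corestr nabla_corestr_linear.

(** Both sides are [nabla (x * nabla v)]. *)
Lemma nabla_equivariant (x : witt a) (v : density a alpha 0) :
  nabla alpha (lie_act x v) = lie_act x (nabla alpha v : density a alpha 1).
Proof. by rewrite density_act1 density_act0. Qed.

Lemma image_submod_isomorphic : ~ integral_weight alpha ->
  lie_isomorphic (lie_submod (image_submod a alpha)) (density a alpha 0).
Proof.
move=> nint; apply: lie_isomorphic_sym.
apply: (@lie_isomorphic_inj_surj _ _ _ _ nabla_corestr) => [f g|y|x v].
- by move=> /(congr1 (@submod_val _ _ _ _)) /(nabla_inj nint).
- have /mem_image_submod[g gy] := valP y; exists g; exact: val_inj.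
by apply: val_inj; exact: nabla_equivariant.
Qed.

Definition nabla_density (g : density a alpha 0) : density a alpha 1 := nabla alpha g.

HB.instance Definition _ := GRing.isLinear.Build F (density a alpha 0)
  (density a alpha 1) *:%R nabla_density (nabla_linear alpha).

Lemma density01_isomorphic : n = 1%N -> ~ integral_weight alpha ->
  lie_isomorphic (density a alpha 0) (density a alpha 1).
Proof.
move=> n1 nint; apply: (@lie_isomorphic_inj_surj _ _ _ _ nabla_density).
- exact: nabla_inj.
- exact/nabla_surjP.
exact: nabla_equivariant.
Qed.

End Main.

Local Open Scope complex_scope.

Theorem theorem22 (R : realType) (n : nat) (a alpha : 'I_n -> R[i]) (beta : R[i])
    (n_ge1 : (1 <= n)%N) (a_distinct : injective a) :
  (* (a) *)
  (lie_reducible (density a alpha beta) <->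
     [\/ beta = 0 /\ integral_weight alpha,
         beta = 1 /\ (2 <= n)%N
       | [/\ beta = 1, n = 1%N & integral_weight alpha]])
  /\
  (* (b) *)
  (beta = 0 -> integral_weight alpha ->
     exists W : lieSubmodule (density a alpha beta),
       [/\ submod_nonzero W, submod_proper W, has_dim (lie_submod W) 1
         & forall W' : lieSubmodule (density a alpha beta),
             submod_nonzero W' -> submod_proper W' -> W' =i W])
  /\
  (* (c) *)
  (beta = 1 ->
     exists W : lieSubmodule (density a alpha beta),
       W =i density_deriv_image a alpha beta /\
       submod_nonzero W /\
       (forall W' : lieSubmodule (density a alpha beta),
             submod_nonzero W' -> {subset W <= W'}) /\
       lie_irreducible (lie_submod W) /\
       lie_trivial (lie_quot W) /\
       ((forall u : lie_quot W, u = 0) <-> n = 1%N /\ ~ integral_weight alpha) /\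
       (forall m : 'I_n -> int, (forall i, alpha i = (m i)%:~R) ->
         let poly_part : {pred ratfun R[i]} :=
           lin_span (fun f => exists k : nat, f = ratC 'X ^+ k) in
         let polar_part : {pred ratfun R[i]} :=
           lin_span (fun f => exists (i : 'I_n) (k : nat),
             (1 <= k)%N /\ f = ratC ('X - (a i)%:P) ^- k.+1) in
         [/\ (forall f : ratfun R[i],
               (exists2 g : density a alpha beta,
                  g \in W & f = ra_val g * ra_monomial a m) <->
               exists p q, [/\ p \in poly_part, q \in polar_part & f = p + q]),
             (forall f, f \in poly_part -> f \in polar_part -> f = 0)
           & has_dim (lie_quot W) n]))
  /\
  (* (d) *)
  (beta = 1 -> ~ integral_weight alpha ->
     exists W : lieSubmodule (density a alpha beta),
       W =i density_deriv_image a alpha beta /\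
       lie_isomorphic (lie_submod W) (density a alpha 0))
  /\
  (* (e) *)
  (n = 1%N -> ~ integral_weight alpha ->
     lie_isomorphic (density a alpha 0) (density a alpha 1)).
Proof.
have char0 : [pchar R[i]] =i pred0 by exact: Num.Theory.pchar_num.
split; first exact: density_reducibleP.
split.
  move=> -> ia; have [m am] := choice ia; exists (ker_submod a alpha); split.
  - by exists (ra_mono a (fun i => - m i)); [exact: mono_ker_submod | exact: ra_mono_neq0].
  - exact: ker_submod_proper.
  - exact: (ker_submod_dim a_distinct char0 n_ge1 am).
  - exact: (submod0_eq_ker a_distinct char0 n_ge1 am).
split.
  move=> ->; exists (image_submod a alpha); split=> //.
  split; first exact: image_submod_nonzero.
  split; first exact: image_submod_smallest.
  split.
    by apply: smallest_irreducible; [exact: image_submod_nonzero | exact: image_submod_smallest].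
  split; first exact: image_quot_trivial.
  split; first exact: image_quot_eq0P.
  move=> m am poly_part polar_part; split.
  - exact: (image_submod_parts a_distinct char0 am).
  - exact: parts_direct.
  - exact: (image_submod_codim a_distinct char0 n_ge1 am).
split.
  by move=> -> nint; exists (image_submod a alpha); split=> //; exact: image_submod_isomorphic.
exact: density01_isomorphic.
Qed.
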